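(* Let $B_r$ be the Boolean lattice of subsets of $[r]=\{1,\dots,r\}$, let $S\subseteq[r-1]$, and let $L=(B_r)_S=\{x\in B_r:|x|\in S\}$. Let $\sigma_1,\dots,\sigma_t$ be the permutations in $S_r$ with descent set $S$, listed in lexicographic order, and let $\mathbf d_i$ be the maximal chain of $B_r$ whose label is $\sigma_i$. For each $i$, writing $\mathbf d_i:\hat 0=x_0<x_1<\dots<x_r=\hat 1$, let $C_i$ be the set of maximal chains $\hat 0=y_0<y_1<\dots<y_r=\hat 1$ of $B_r$ with $y_j=x_j$ for all $j\notin S$; let $L_i=\{z\in L: z\in\mathbf c\text{ for some }\mathbf c\in C_i\}$ with the induced order; let $E_i$ be the set of maximal chains of $L_i$ that are not maximal chains of $L_j$ for any $j<i$; and let $\Sigma_i$ be the simplicial complex whose facets are the chains in $E_i$. Then $\Sigma_1,\Sigma_2,\dots,\Sigma_t$ is a convex-ear decomposition of the order complex $\Delta(L)$.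
   Context: The label of a maximal chain $\hat 0=x_0<x_1<\dots<x_r=\hat 1$ of $B_r$ is the word $\lambda(x_0,x_1)\lambda(x_1,x_2)\cdots\lambda(x_{r-1},x_r)$, where $\lambda(x,y)=k$ if $y=x\cup\{k\}$ with $k\notin x$; each permutation in $S_r$ (written as a word) is the label of exactly one maximal chain. The descent set of a word $a_1a_2\cdots a_m$ is $\{i:a_i>a_{i+1}\}$. The order complex $\Delta(P)$ of a poset $P$ is the simplicial complex whose simplices are the chains of $P$. A sequence of subcomplexes $\Sigma_1,\dots,\Sigma_n$ of a $(d-1)$-dimensional simplicial complex $\Delta$ is a convex-ear decomposition of $\Delta$ if: (i) $\bigcup_{i=1}^n\Sigma_i=\Delta$; (ii) $\Sigma_1$ is the boundary complex of a simplicial $d$-polytope, and for $i>1$, $\Sigma_i$ is a full-dimensional (i.e. $(d-1)$-dimensional) proper subcomplex of the boundary complex of some simplicial $d$-polytope; (iii) for $i>1$, $\Sigma_i$ is a simplicial ball; (iv) for $i>1$, $\left(\bigcup_{j=1}^{i-1}\Sigma_j\right)\cap\Sigma_i=\partial\Sigma_i$. (Being a boundary complex, or subcomplex thereof, is meant up to isomorphism.) *)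

(* Defs.v *)
From HB Require Import structures.
From mathcomp Require Import all_boot all_order all_fingroup all_algebra.
From mathcomp Require Import all_classical all_reals topology normedtype.

Set Implicit Arguments.
Unset Strict Implicit.
Unset Printing Implicit Defensive.

Import Order.TTheory GRing.Theory Num.Theory.
Import numFieldNormedType.Exports.

(** * Finite abstract simplicial complexes

    A complex is a set of finite sets; the empty face is a face of every
    complex, and the elements of the ambient type need not all be vertices. *)

Section SimplicialComplexes.
Variable T : finType.
Implicit Types (K : {set {set T}}) (A F G : {set T}).

Definition simplicial_complex K : bool :=
  (finset.set0 \in K) && [forall A in K, powerset A \subset K].

Definition vertices K : {set T} := finset.cover K.

(* dim K + 1, so that the complex {set0} has value 0 *)
Definition dim1 K : nat := \max_(A in K) #|A|.

Definition facets K : {set {set T}} := [set F | maxset (fun G => G \in K) F].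

(* The closure of an antichain E is the complex with set of facets E. *)
Definition complex_of_facets (E : {set {set T}}) : {set {set T}} :=
  [set A : {set T} | [exists F in E, A \subset F]].

(* The boundary of a simplicial ball: the complex generated by the faces of
   codimension one which lie in exactly one facet *)
Definition ball_boundary K : {set {set T}} :=
  complex_of_facets
    [set G in K | (#|G|.+1 == dim1 K) &&
                  (#|[set F in facets K | G \subset F]| == 1)].

End SimplicialComplexes.

(** * Order complexes *)

Section OrderComplexes.
Context {disp : Order.disp_t} {P : finPOrderType disp}.
Implicit Types (L c : {set P}).

Definition is_chain c : bool := [forall x in c, forall y in c, (x >=< y)%O].

(* A subset L of P stands for the poset L with the induced order. *)
Definition order_complex L : {set {set P}} :=
  [set c : {set P} | (c \subset L) && is_chain c].

Definition maximal_chains L : {set {set P}} :=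
  [set c | maxset (fun c' => (c' \subset L) && is_chain c') c].

End OrderComplexes.

(** * Simplicial polytopes *)

Section Polytopes.
Local Open Scope ring_scope.
Local Open Scope classical_set_scope.
Variable R : realType.

(* The points are the rows of V. *)
Definition conv_hull m n (V : 'M[R]_(m, n)) : set 'rV[R]_n :=
  [set x | exists a : 'rV[R]_m,
     [/\ forall i, 0 <= a 0 i, \sum_i a 0 i = 1 & x = a *m V]].

(* Affine relations between the points x_i are linear relations between the
   vectors (x_i, 1). *)
Definition homogenize m n (V : 'M[R]_(m, n)) : 'M[R]_(m, n + 1) :=
  row_mx V (const_mx 1).

(* The rank of the homogenized points is 1 + the dimension of their affine
   hull. *)
Definition polytope n (d : nat) (P : set 'rV[R]_n) : Prop :=
  exists m (V : 'M[R]_(m, n)), P = conv_hull V /\ \rank (homogenize V) = d.+1.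

(* With m = 0 this includes the empty simplex. *)
Definition simplex n (F : set 'rV[R]_n) : Prop :=
  exists m (V : 'M[R]_(m, n)), F = conv_hull V /\ row_free (homogenize V).

(* Zero functionals are allowed, so that set0 and P are faces of P. *)
Definition face n (P F : set 'rV[R]_n) : Prop :=
  exists (l : 'cV[R]_n) (c : R),
    (forall x, P x -> (x *m l) 0 0 <= c) /\
    F = [set x | P x /\ (x *m l) 0 0 = c].

Definition proper_face n (P F : set 'rV[R]_n) : Prop := face P F /\ F <> P.

Definition polytope_vertices n (P : set 'rV[R]_n) : set 'rV[R]_n :=
  [set x | face P [set x]].

Definition simplicial_polytope n (d : nat) (P : set 'rV[R]_n) : Prop :=
  polytope d P /\ forall F, proper_face P F -> simplex F.

(* The abstract simplicial complex of the vertex sets of the proper faces *)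
Definition boundary_complex n (P : set 'rV[R]_n) : set (set 'rV[R]_n) :=
  [set A | exists2 F, proper_face P F & A = polytope_vertices P `&` F].

(* The image of K under a relabelling f of its vertices *)
Definition relabel (T : finType) (U : Type) (f : T -> U) (K : {set {set T}}) :
    set (set U) :=
  [set f @` [set` A] | A in [set` K]].

Definition is_polytope_boundary (T : finType) (d : nat) (K : {set {set T}}) :
    Prop :=
  exists n (P : set 'rV[R]_n) (f : T -> 'rV[R]_n),
    [/\ simplicial_polytope d P, {in vertices K &, injective f}
      & relabel f K = boundary_complex P].

Definition is_proper_in_polytope_boundary (T : finType) (d : nat)
    (K : {set {set T}}) : Prop :=
  exists n (P : set 'rV[R]_n) (f : T -> 'rV[R]_n),
    [/\ simplicial_polytope d P, {in vertices K &, injective f}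
      & relabel f K `<` boundary_complex P].

(** * Simplicial balls *)

(* The geometric realization of K in R^T, in barycentric coordinates *)
Definition realization (T : finType) (K : {set {set T}}) : set 'rV[R]_#|T| :=
  [set a | [/\ forall i, 0 <= a 0 i, \sum_i a 0 i = 1
             & [set x : T | a 0 (enum_rank x) != 0]%SET \in K]].

Definition closed_ball_of_dim (e : nat) : set 'rV[R]_e :=
  [set x | \sum_i x 0 i ^+ 2 <= 1].
Arguments closed_ball_of_dim e : clear implicits.

Definition homeomorphic (X Y : topologicalType) (A : set X) (B : set Y) : Prop :=
  exists (f : X -> Y) (g : Y -> X),
    [/\ {within A, continuous f}, {within B, continuous g},
        (forall x, A x -> B (f x) /\ g (f x) = x)
      & (forall y, B y -> A (g y) /\ f (g y) = y)].

Definition simplicial_ball (T : finType) (K : {set {set T}}) : Prop :=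
  simplicial_complex K /\
  homeomorphic (realization K) (closed_ball_of_dim (dim1 K).-1).

End Polytopes.

(** * Convex-ear decompositions *)

(* The terms of the sequence are indexed from 0. *)
Definition convex_ear_decomposition (R : realType) (T : finType)
    (Delta : {set {set T}}) (Sigma : seq {set {set T}}) : Prop :=
  let d := dim1 Delta in
  let n := size Sigma in
  let Sg i := nth finset.set0 Sigma i in
  [/\ simplicial_complex Delta, 0 < n
    & forall i, i < n -> simplicial_complex (Sg i) && (Sg i \subset Delta)] /\
  [/\ (\bigcup_(i < n) Sg i)%SET = Delta,
      is_polytope_boundary R d (Sg 0) /\
      (forall i, 0 < i < n ->
         dim1 (Sg i) = d /\ is_proper_in_polytope_boundary R d (Sg i)),
      forall i, 0 < i < n -> simplicial_ball R (Sg i)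
    & forall i, 0 < i < n ->
        ((\bigcup_(j < i) Sg j) :&: Sg i)%SET = ball_boundary (Sg i)].

(** * Rank-selected Boolean lattices

    The ground set [r] is modelled by 'I_r, which shifts all labels by one.
    The ranks of B_r are the elements of 'I_r.+1. *)

Import Order.DefaultSetSubsetOrder Order.DefaultSeqLexiOrder.

Section BooleanLattice.
Variable r : nat.
Local Notation B := {set 'I_r}.
Implicit Types (c d : r.+1.-tuple B) (s : 'S_r) (S : {set 'I_r.+1}).

Definition rank_selected S : {set B} := [set x : B | [exists j in S, #|x| == j]].

(* The chain is given as the sequence x_0 < ... < x_r. *)
Definition is_maximal_chain c : bool :=
  [&& tnth c ord0 == \bot%O, tnth c ord_max == \top%O & sorted <%O c].

(* lambda(x_j, x_(j+1)) = s_j for all j *)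
Definition has_label c s : bool :=
  [forall j : 'I_r, (s j \notin tnth c (inord j)) &&
     (tnth c (inord j.+1) == tnth c (inord j) :|: [set s j]%SET)].

Definition word s : seq nat := [seq val (s i) | i <- enum 'I_r].

(* With the letters of a word numbered from 1, a descent i compares the i-th and the
   (i+1)-st letter. *)
Definition descent_set s : {set 'I_r.+1} :=
  [set i : 'I_r.+1 | (0 < i < r) && (nth 0 (word s) i < nth 0 (word s) i.-1)].

(* <=%O on seq nat is the lexicographic order. *)
Definition perms_with_descents S : seq 'S_r :=
  sort (fun s t => (word s <= word t)%O)
    (enum [set s : 'S_r | descent_set s == S]).

Lemma perm_chain_subproof s :
  exists c : r.+1.-tuple B, is_maximal_chain c && has_label c s.
Proof.
pose x (k : nat) : B := [set s i | i in 'I_r & i < k].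
have mem_x k i : (s i \in x k) = (i < k).
  apply/imsetP/idP => [[j] | ik]; last by exists i; rewrite ?inE.
  by rewrite inE => jk /perm_inj ->.
pose c : r.+1.-tuple B := [tuple x j | j < r.+1].
have cE (j : 'I_r.+1) : tnth c j = x j by rewrite tnth_mktuple.
have nthE k : k < r.+1 -> nth finset.set0 c k = x k.
  by move=> kr; rewrite -(tnth_nth _ c (Ordinal kr)) cE.
have mem_x' k a : (a \in x k) = ((s^-1)%g a < k) by rewrite -mem_x permKV.
exists c; apply/andP; split; last first.
  apply/forallP => j; rewrite !cE !inordK ?ltnS ?ltn_ord 1?ltnW ?ltnS ?ltn_ord //.
  rewrite mem_x ltnn /=; apply/eqP/setP => a.
  rewrite !inE !mem_x' ltnS leq_eqVlt orbC; congr (_ || _).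
  by rewrite (inj_eq val_inj) (can2_eq (permKV s) (permK s)).
apply/and3P; split.
- by rewrite cE Order.SetSubsetOrder.botEsubset; apply/eqP/setP => a; rewrite mem_x' inE.
- by rewrite cE Order.SetSubsetOrder.topEsubset; apply/eqP/setP => a; rewrite mem_x' inE ltn_ord.
apply/(sortedP finset.set0) => i; rewrite size_tuple ltnS => ir.
rewrite !nthE ?ltnS ?(ltnW ir) //.
rewrite lt_neqAle; apply/andP; split.
  apply/eqP => /setP/(_ (s (Ordinal ir))).
  by rewrite !mem_x /= ltnn ltnSn.
rewrite Order.SetSubsetOrder.leEsubset; apply/fintype.subsetP => a; rewrite !mem_x'; exact: ltnW.
Qed.

(* There is only one such chain, so the choice is immaterial. *)
Definition perm_chain s : r.+1.-tuple B := xchoose (perm_chain_subproof s).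

Definition chains_agreeing_off S d : {set r.+1.-tuple B} :=
  [set c | is_maximal_chain c &
           [forall j : 'I_r.+1, (j \notin S) ==> (tnth c j == tnth d j)]].

Definition ear_subposet S d : {set B} :=
  [set z in rank_selected S | [exists c in chains_agreeing_off S d, z \in c]].

Definition nth_maximal_chains S (i : nat) : {set {set B}} :=
  maximal_chains
    (ear_subposet S (perm_chain (nth 1%g (perms_with_descents S) i))).

(* The maximal chains of the i-th subposet, counted from 0, which belong to no
   earlier one *)
Definition ear_facets S (i : nat) : {set {set B}} :=
  (nth_maximal_chains S i :\: \bigcup_(j < i) nth_maximal_chains S j)%SET.

Definition ears S : seq {set {set B}} :=
  mkseq (fun i => complex_of_facets (ear_facets S i))
    (size (perms_with_descents S)).

End BooleanLattice.

(* Main.v *)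
(** Fixing the members of a chain at the ranks outside S cuts a permutation into
    blocks, and L_i depends only on the ordered partition of [r] into the blocks
    of sigma_i.  A maximal chain of L_i is a permutation t with these blocks.
    It lies in E_i if and only if t ascends at every rank outside S: given a
    maximal chain of L, the permutation t that completes it increasingly between
    the ranks of S has the block partition whose blockwise decreasing
    rearrangement comes first lexicographically.

    A face A of Sigma_i lies in an earlier ear exactly if some inversion of
    letters of different blocks is separated by no member of A.  In that case
    start from a facet in E_i above A and transpose adjacent letters at descents
    whose rank is in S and is not the rank of a member of A.  This must lead out
    of E_i, and the step that does so shows that A is in the boundary.

    Send z in L_i to its indicator vector modulo the constant vectors on each
    block, divided by the number cut z of pairs (a, b) in a common block with
    a in z and b not in z.  As the indicators are modular in z and cut is
    strictly submodular, two incomparable z never lie on a common proper face of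
    the convex hull of these points, and the proper faces are the simplices
    spanned by the chains of L_i.

    In the fan over this polytope the cone over Sigma_i consists of the vectors
    u such that, for all consecutive blocks, the letter minimizing u in the first
    one is smaller than the letter maximizing u in the second one (ties broken
    suitably).  Adding a positive multiple of the vector (a)_a of the letters
    themselves preserves this.  Hence the cone is the set psi >= 0 for a
    continuous, positively homogeneous psi that grows with unit speed along this
    vector, and its section is a ball. *)

Require Import Defs.
From mathcomp Require Import all_boot all_order all_fingroup all_algebra.
From mathcomp Require Import zify ring lra.

Set Implicit Arguments.
Unset Strict Implicit.
Unset Printing Implicit Defensive.

Import Order.TTheory GRing.Theory Num.Theory.

(** * Permutations and chains of subsets *)

Lemma lexi_word_leP (u v : seqlexi nat) : size u = size v ->
  (forall l, l < size u -> (forall m, m < l -> nth 0 u m = nth 0 v m) ->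
     nth 0 u l <= nth 0 v l) ->
  (u <= v)%O.
Proof.
elim: u v => [|a u IHu] [|b v] //= [uv] H.
rewrite Order.SeqLexiOrder.lexi_cons; have /= ab := H 0 isT (fun m => ltac:(by [])).
rewrite leEnat ab /=; apply/implyP => ba; apply: IHu => // l lu Hl.
apply: (H l.+1) => // -[|m] /= ml; last exact: Hl.
by apply/eqP; rewrite eqn_leq ab.
Qed.

Section PrefixSets.
Variable r : nat.
Implicit Types (s t : 'S_r) (a b : 'I_r) (z w : {set 'I_r}) (C : {set {set 'I_r}}).

Definition position s a : nat := (s^-1)%g a.

Lemma position_inj s : injective (position s).
Proof. by move=> a b /val_inj/perm_inj. Qed.

Lemma position_lt s a : position s a < r.
Proof. exact: ltn_ord. Qed.

Lemma letter_at s k : k < r -> exists a, position s a = k.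
Proof. by move=> kr; exists (s (Ordinal kr)); rewrite /position permK. Qed.

Lemma position_inj2 s t : position s =1 position t -> s = t.
Proof.
move=> st; suff: (s^-1 = t^-1)%g by move/invg_inj.
by apply/permP => a; apply/val_inj; exact: st.
Qed.

Definition prefix_set s k : {set 'I_r} := [set a | position s a < k].

Lemma card_prefix_set s k : k <= r -> #|prefix_set s k| = k.
Proof.
move=> kr.
have -> : prefix_set s k = s @: [set i : 'I_r | i < k].
  apply/setP => a; rewrite inE; apply/idP/imsetP => [ak|[i]].
    by exists ((s^-1)%g a); rewrite ?inE ?permKV.
  by rewrite inE => ik ->; rewrite /position permK.
rewrite card_imset; last exact: perm_inj.
rewrite -sum1_card (eq_bigl (fun i : 'I_r => i < k)) => [|i]; last by rewrite inE.
by rewrite -(big_ord_widen_cond r xpredT (fun=> 1)) // sum1_card card_ord.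
Qed.

Lemma prefix_set_mono s k l : k <= l -> prefix_set s k \subset prefix_set s l.
Proof. by move=> kl; apply/subsetP => a; rewrite !inE => /leq_trans; exact. Qed.

Definition nested z w := (z \subset w) || (w \subset z).

Lemma nested_sym z w : nested z w = nested w z.
Proof. by rewrite /nested orbC. Qed.

Lemma prefix_set_nested s k l : nested (prefix_set s k) (prefix_set s l).
Proof.
by apply/orP; case: (leqP k l) => [|/ltnW] /(prefix_set_mono s) ->; [left|right].
Qed.

Lemma nestedP z w a b : nested z w -> a \in z -> a \notin w -> b \in w -> b \in z.
Proof. by move=> /orP[]/subsetP zw az; [rewrite zw|move=> _; exact: zw]. Qed.

Lemma nested_card z w : nested z w -> #|z| = #|w| -> z = w.
Proof.
by move=> /orP[] zw e; [|apply/esym]; apply/eqP; rewrite eqEcard zw e leqnn.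
Qed.

Lemma initial_prefix_set s z :
  (forall a b, a \in z -> b \notin z -> position s a < position s b) ->
  z = prefix_set s #|z|.
Proof.
move=> zs; have zr : #|z| <= r by rewrite -[X in _ <= X]card_ord max_card.
apply: nested_card; last by rewrite card_prefix_set.
apply/negPn/negP; rewrite negb_or => /andP[/subsetPn[a az]]. rewrite inE => a1.
move=> /subsetPn[b]; rewrite inE => b1 bz; have := zs _ _ az bz; lia.
Qed.

Definition chain_set C := [forall z in C, forall w in C, nested z w].

Lemma chain_setP C : reflect {in C &, forall z w, nested z w} (chain_set C).
Proof.
apply: (iffP forall_inP) => [H z w zC wC|H z zC].
  by move/forall_inP: (H z zC); apply.
by apply/forall_inP => w; exact: H.
Qed.

Lemma chain_setS C C' : C \subset C' -> chain_set C' -> chain_set C.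
Proof.
by move=> /subsetP CC /chain_setP H; apply/chain_setP => z w /CC zC /CC wC; exact: H.
Qed.

Lemma sorting_perm (d : Order.disp_t) (K : orderType d) (key : 'I_r -> K) :
  exists s, forall a b, position s a < position s b -> (key a <= key b)%O.
Proof.
pose e := sort (relpre key <=%O) (enum 'I_r).
have se : size e = r by rewrite size_sort size_enum_ord.
have ue : uniq e by rewrite sort_uniq enum_uniq.
have inj : injective (fun i : 'I_r => nth i e i).
  move=> i j; rewrite (set_nth_default j) ?se // => /eqP.
  by rewrite nth_uniq ?se // => /eqP/val_inj.
exists (perm inj) => a b.
have eE (c : 'I_r) : c = nth a e (position (perm inj) c).
  rewrite -[in LHS](permKV (perm inj) c) permE; apply: set_nth_default.
  by rewrite se.
rewrite [in key a](eE a) [in key b](eE b).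
apply: (sorted_ltn_nth (leT := relpre key <=%O)); rewrite ?inE ?se ?position_lt //.
  by move=> x y z /= /le_trans; apply.
by apply: sort_sorted => x y; exact: le_total.
Qed.

(** The letters are sorted by the pair of [depth a], the number of members of [C] missing [a], and
    the key. As [C] is a chain, a letter in a member has smaller depth than any letter outside it,
    so the members become initial segments. Letters that no member separates have equal depth and
    fall to the key. *)
Lemma refining_perm C (d : Order.disp_t) (K : orderType d) (key : 'I_r -> K) :
  chain_set C ->
  exists s, {in C, forall z, z = prefix_set s #|z|} /\
    forall a b, position s a < position s b ->
      {in C, forall z, (a \in z) = (b \in z)} -> (key a <= key b)%O.
Proof.
move=> /chain_setP HC.
pose depth a := #|[set z in C | a \notin z]|.
have [s Hs] := sorting_perm (fun a => (depth a, key a) : (nat *l K)%type).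
have depthlt z a b : z \in C -> a \in z -> b \notin z -> depth a < depth b.
  move=> zC az bz; apply/proper_card/properP; split.
    apply/subsetP => w; rewrite !inE => /andP[wC aw]; rewrite wC.
    by apply: contra bz => /(nestedP (HC _ _ zC wC) az aw).
  by exists z; rewrite !inE ?zC ?az.
exists s; split.
  move=> z zC; apply: initial_prefix_set => a b az bz; rewrite ltnNge leq_eqVlt.
  apply/negP => /orP[/eqP/position_inj ba|/Hs]; first by rewrite ba az in bz.
  rewrite Order.ProdLexiOrder.leEprodlexi /= leEnat => /andP[+ _].
  by rewrite leqNgt (depthlt z).
move=> a b /Hs; rewrite Order.ProdLexiOrder.leEprodlexi /= => /andP[_ /implyP H] ab.
apply: H; rewrite leEnat (_ : depth b = depth a) //; congr #|pred_of_set _|.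
by apply/setP => z; rewrite !inE; case zC: (z \in C) => //=; rewrite ab.
Qed.

End PrefixSets.

(** * Rank selection and blocks *)

Section RankSelection.
Variables (r : nat) (S : {set 'I_r.+1}).
Implicit Types (s t : 'S_r) (a b c : 'I_r) (z w : {set 'I_r}) (A : {set {set 'I_r}}).

Definition selected (k : nat) := [exists j in S, k == j].

Hypothesis hS : forall j : 'I_r.+1, j \in S -> 0 < j < r.

Lemma selected_ord (j : 'I_r.+1) : selected j = (j \in S).
Proof.
apply/exists_inP/idP => [[i iS /eqP/val_inj->] //|jS]; by exists j.
Qed.

Lemma selected_bounds k : selected k -> 0 < k < r.
Proof. by case/exists_inP => j /hS jr /eqP ->. Qed.

Lemma unselected0 : ~~ selected 0.
Proof. by apply/negP => /selected_bounds. Qed.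

(** Agreement at all ranks outside [S] means that both permutations cut the letters into the same
    ordered partition into blocks. *)
Definition eq_off s t := forall j, ~~ selected j -> prefix_set s j = prefix_set t j.

Lemma eq_off_sym s t : eq_off s t -> eq_off t s.
Proof. by move=> st j /st. Qed.

Lemma eq_off_trans s t u : eq_off s t -> eq_off t u -> eq_off s u.
Proof. by move=> st tu j jS; rewrite st ?tu. Qed.

Definition same_block s a b :=
  [forall j : 'I_r.+1, (j \notin S) ==> ((a \in prefix_set s j) == (b \in prefix_set s j))].

Lemma prefix_set_ge s j : r <= j -> prefix_set s j = setT.
Proof. by move=> rj; apply/setP => a; rewrite !inE (leq_trans (position_lt _ _)). Qed.

Lemma same_blockP s a b :
  reflect (forall j, ~~ selected j -> (a \in prefix_set s j) = (b \in prefix_set s j))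
    (same_block s a b).
Proof.
apply: (iffP forall_inP) => [H j|H j jS]; last by apply/eqP/H; rewrite selected_ord.
case: (ltnP j r.+1) => [jr|/ltnW rj _]; last by rewrite prefix_set_ge ?inE.
by rewrite (selected_ord (Ordinal jr)) => /H/eqP.
Qed.

Lemma same_block_sym s a b : same_block s a b = same_block s b a.
Proof. by apply/same_blockP/same_blockP => H j /H ->. Qed.

Lemma same_block_eq_off s t : eq_off s t -> same_block s =2 same_block t.
Proof.
by move=> st a b; apply/same_blockP/same_blockP => H j jS; have := H j jS; rewrite st.
Qed.

(** Positions count from 0, so the rank separating [b] from the letter just before it is
    [position s b]; hence the half-open interval. *)
Lemma same_block_position s a b : position s a <= position s b ->
  reflect (forall j, position s a < j <= position s b -> selected j) (same_block s a b).
Proof.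
move=> ab; apply: (iffP (same_blockP _ _ _)) => H j.
  move=> jab; apply: contraT => /H; rewrite !inE; lia.
move=> jS; rewrite !inE; have := contra (H j) jS; lia.
Qed.

(** The descent set is contained in [S]; [descending] below says that it contains [S] (see
    [descent_setP]). *)
Definition ascending s := [forall a, forall b,
  ((position s a).+1 == position s b) && ~~ selected (position s b) ==> (a < b)].

Lemma ascendingP s : reflect (forall a b, (position s a).+1 = position s b ->
  ~~ selected (position s b) -> a < b) (ascending s).
Proof.
apply: (iffP forallP) => [H a b /eqP ab bS|H a].
  by move/forallP/(_ b)/implyP: (H a); rewrite ab bS; apply.
by apply/forallP => b; apply/implyP => /andP[/eqP]; exact: H.
Qed.

Definition descending s := forall a b, (position s a).+1 = position s b ->
  selected (position s b) -> b < a.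

Lemma descending_block s a b : descending s -> same_block s a b ->
  position s a < position s b -> b < a.
Proof.
move=> ds ab lt_ab; move: {2}(position s b) (erefl (position s b)) => n.
elim: n b ab lt_ab => [|n IH] b ab lt_ab bn; first by rewrite bn in lt_ab.
have [c cn] : exists c, position s c = n.
  by apply: letter_at; rewrite -ltnS -bn ltnW // ltnS position_lt.
have H : forall j, position s a < j <= position s b -> selected j.
  by apply/same_block_position => //; exact: ltnW.
have bc : b < c by apply: ds; rewrite ?cn ?bn //; apply: H; lia.
have [/position_inj -> //|ac] := eqVneq (position s a) (position s c).
apply: (ltn_trans bc); apply: IH; rewrite ?cn //; last by lia.
apply/same_block_position; first by lia.
by move=> j jac; apply: H; lia.
Qed.

Lemma descent_between s a b : position s a < position s b -> b < a ->
  exists c d, [/\ (position s c).+1 = position s d, d < c &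
    position s a < position s d <= position s b].
Proof.
move=> lt_ab; move: {2}(position s b) (erefl (position s b)) => n.
elim: n b lt_ab => [|n IH] b lt_ab bn ba; first by rewrite bn in lt_ab.
have [c cn] : exists c, position s c = n.
  by apply: letter_at; rewrite -ltnS -bn ltnW // ltnS position_lt.
have [bc|cb] := ltnP b c; first by exists c, b; split; lia.
have [/position_inj ac|ac] := eqVneq (position s a) (position s c).
  by rewrite ac in ba; lia.
have [||//|e [d [H1 H2 H3]]] := IH c; try lia.
by exists e, d; split=> //; lia.
Qed.

(* The faces of the ear of [s] that lie in no earlier ear are those whose
   vertices separate every inversion [h < g] between different blocks of [s]. *)
Definition separating A s := forall g h : 'I_r, h < g ->
  (exists2 j, ~~ selected j & (g \in prefix_set s j) && (h \notin prefix_set s j)) ->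
  exists2 z, z \in A & (g \in z) && (h \notin z).

Lemma nth_word s m a : position s a = m ->
  nth 0 [seq val (s i) | i <- enum 'I_r] m = a.
Proof.
move=> am; have mr : m < r by rewrite -am position_lt.
rewrite (nth_map (Ordinal mr)) ?size_enum_ord // -[m]/(val (Ordinal mr)).
by rewrite nth_ord_enum -[in RHS](permKV s a); congr (val (s _)); apply/val_inj.
Qed.

(** Suppose that at the first difference [s] has [g] and [t] has a smaller letter [h']. Since [t]
    decreases inside blocks, [g] lies in a later block of [t] than [h']. Some letter [h] of the
    block of [h'] in [t] must then lie in a later block of [s] than [g], and [h <= h' < g]. A member
    of [A] separates this inversion of [s], but it would cross the prefix set of [t] ending the
    block of [h']. *)
Lemma separating_word_le A s t : descending s -> descending t -> separating A s ->
  (forall z j, z \in A -> ~~ selected j -> nested z (prefix_set t j)) ->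
  ([seq val (s i) | i <- enum 'I_r] <= [seq val (t i) | i <- enum 'I_r] :> seqlexi nat)%O.
Proof.
move=> ds dt sepA nestA; apply: lexi_word_leP => [|l]; first by rewrite !size_map.
rewrite size_map size_enum_ord => lr Hl.
have [g gl] := letter_at s lr; have [h' hl] := letter_at t lr.
rewrite (nth_word gl) (nth_word hl) leqNgt; apply/negP => h'g.
have agree a : (position s a < l) || (position t a < l) -> position s a = position t a.
  move=> al; have : exists2 m, m < l & (position s a == m) || (position t a == m).
    by case/orP: al => al; [exists (position s a)|exists (position t a)]; rewrite ?eqxx ?orbT.
  case=> m ml am; have mr : m < r by lia.
  have [b bm] := letter_at s mr; have [c cm] := letter_at t mr.
  have := Hl m ml; rewrite (nth_word bm) (nth_word cm) => /val_inj bc.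
  rewrite -bc in cm; case/orP: am => /eqP am.
    by rewrite (position_inj (etrans am (esym bm))) bm cm.
  by rewrite (position_inj (etrans am (esym cm))) bm cm.
(* The block at position [l] ends at the next unselected rank [m], in both words alike. Rank [r] is
   always a candidate. *)
have [m /andP[lm mS] minm] : exists2 m, (l < m) && ~~ selected m &
    forall j, (l < j) && ~~ selected j -> m <= j.
  have ex : exists m, (l < m) && ~~ selected m.
    by exists r; rewrite lr; apply/negP => /selected_bounds; rewrite ltnn andbF.
  by exists (ex_minn ex); case: ex_minnP.
have blk u a b : position u a = l -> l < position u b < m -> same_block u a b.
  move=> al bm; apply/same_block_position; first by lia.
  move=> j jab; apply: contraT => jS; have := minm j; rewrite jS; lia.
have mr : m <= r.
  by apply: minm; rewrite lr; apply/negP => /selected_bounds; rewrite ltnn andbF.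
have gt : g \notin prefix_set t m.
  rewrite inE; apply/negP => gm.
  have gl' : l <= position t g.
    by rewrite leqNgt; apply/negP => H; have := agree g; rewrite H orbT; lia.
  have [/position_inj e|ne] := eqVneq (position t h') (position t g).
    by rewrite e ltnn in h'g.
  have := descending_block dt (blk t h' g hl _); lia.
have [h] : exists2 h, h \in prefix_set t m & h \notin prefix_set s m.
  apply/subsetPn; apply: contra gt => ts.
  by rewrite (nested_card (_ : nested (prefix_set t m) (prefix_set s m)))
     ?card_prefix_set ?inE ?gl // /nested ts.
rewrite !inE => ht hs.
have hlt : l <= position t h.
  by rewrite leqNgt; apply/negP => H; have := agree h; rewrite H orbT; lia.
have hg : h < g.
  have [/position_inj <- //|ne] := eqVneq (position t h') (position t h).
  have := descending_block dt (blk t h' h hl _); lia.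
have [|z zA /andP[gz hz]] := sepA g h hg.
  by exists m; rewrite // !inE gl lm.
by rewrite (nestedP (nestA z m zA mS) gz gt) ?inE in hz.
Qed.

Definition facet s : {set {set 'I_r}} := [set prefix_set s j | j : 'I_r.+1 in S].

Lemma mem_facet s j : selected j -> prefix_set s j \in facet s.
Proof. by case/exists_inP => i iS /eqP ->; apply: imset_f. Qed.

Lemma facetP s z : reflect (exists2 j, selected j & z = prefix_set s j) (z \in facet s).
Proof.
apply: (iffP imsetP) => [[j jS ->]|[j jS ->]].
  by exists j; rewrite ?selected_ord.
by case/exists_inP: jS => i iS /eqP ->; exists i.
Qed.

Lemma selected_le j : selected j -> j <= r.
Proof. by move=> /selected_bounds; lia. Qed.

Lemma mem_facet_card s z : z \in facet s -> selected #|z| /\ z = prefix_set s #|z|.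
Proof. by move=> /facetP[j jS ->]; rewrite card_prefix_set ?selected_le. Qed.

Lemma card_facet s : #|facet s| = #|S|.
Proof.
apply: card_in_imset => i j iS jS /(congr1 (fun z : {set _} => #|z|)).
have le_r (k : 'I_r.+1) : k <= r by have := ltn_ord k.
by rewrite !card_prefix_set // => /val_inj.
Qed.

Lemma facet_chain s : chain_set (facet s).
Proof.
by apply/chain_setP => z w /facetP[j _ ->] /facetP[k _ ->]; exact: prefix_set_nested.
Qed.

(** The poset L_i without its chains: a set of selected size lies on a maximal chain through the
    fixed members once it is comparable to each of them ([ear_subposetE]). *)
Definition ear_vertices s : {set {set 'I_r}} :=
  [set z : {set 'I_r} | selected #|z| &&
    [forall j : 'I_r.+1, (j \notin S) ==> nested z (prefix_set s j)]].

Lemma ear_verticesP s z :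
  reflect (selected #|z| /\ forall j, ~~ selected j -> nested z (prefix_set s j))
    (z \in ear_vertices s).
Proof.
rewrite inE; apply: (iffP andP) => -[zS H]; split=> //.
  move=> j; case: (ltnP j r.+1) => [jr|/ltnW rj _].
    by rewrite (selected_ord (Ordinal jr)) => /(forall_inP H).
  by rewrite (prefix_set_ge _ rj) /nested finset.subsetT.
by apply/forall_inP => j jS; apply: H; rewrite selected_ord.
Qed.

Lemma ear_vertices_eq_off s t : eq_off s t -> ear_vertices s = ear_vertices t.
Proof.
move=> st; apply/setP => z; apply/ear_verticesP/ear_verticesP => -[zS H]; split=> // j jS.
  by rewrite -st // H.
by rewrite st // H.
Qed.

Lemma facet_sub s t : eq_off s t -> facet t \subset ear_vertices s.
Proof.
move=> st; rewrite (ear_vertices_eq_off st); apply/subsetP => z zt.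
apply/ear_verticesP; have [zS ->] := mem_facet_card zt.
by rewrite card_prefix_set ?selected_le //; split=> // j _; exact: prefix_set_nested.
Qed.

(** [A] and the fixed members of the chain of [s] together form a chain, which some permutation
    refines. The key orders the letters left unseparated: a reversing key gives decreasing blocks,
    and the levels of a vector find a cone containing it. *)
Lemma extend_facet s A (d : Order.disp_t) (K : orderType d) (key : 'I_r -> K) :
  A \subset ear_vertices s -> chain_set A ->
  exists t, [/\ eq_off s t, A \subset facet t &
    forall a b, position t a < position t b -> same_block t a b ->
      {in A, forall z, (a \in z) = (b \in z)} -> (key a <= key b)%O].
Proof.
move=> /subsetP As /chain_setP chA.
pose C := A :|: [set prefix_set s j | j : 'I_r.+1 in ~: S].
have chC : chain_set C.
  have nes z w : z \in A -> w \in [set prefix_set s j | j : 'I_r.+1 in ~: S] -> nested z w.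
    move=> /As/ear_verticesP[_ H] /imsetP[j]; rewrite inE => jS ->.
    by apply: H; rewrite selected_ord.
  apply/chain_setP => z w /setUP[zA|zC] /setUP[wA|wC].
  - exact: chA.
  - exact: nes.
  - by rewrite nested_sym nes.
  - by move: zC wC => /imsetP[j _ ->] /imsetP[k _ ->]; exact: prefix_set_nested.
have [t [Ht tie]] := refining_perm key chC.
have st : eq_off s t.
  move=> j; case: (ltnP j r.+1) => [jr|/ltnW rj _]; last by rewrite !prefix_set_ge.
  rewrite (selected_ord (Ordinal jr)) => jS.
  have /Ht : prefix_set s j \in C.
    by apply/setUP; right; apply/imsetP; exists (Ordinal jr); rewrite ?inE.
  by rewrite card_prefix_set.
exists t; split=> //.
  apply/subsetP => z zA; have /Ht -> : z \in C by rewrite inE zA.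
  by apply: mem_facet; case/ear_verticesP: (As z zA).
move=> a b ab bl tA; apply: tie => // z /setUP[/tA //|/imsetP[j]].
rewrite inE => jS ->; rewrite st ?selected_ord //.
by move/same_blockP: bl; apply; rewrite selected_ord.
Qed.

(** Letters not separated by [A] are put in increasing order. A descent can then occur only at the
    size of a member of [A], which is a selected rank. *)
Lemma extend_ascending A : chain_set A -> {in A, forall z, selected #|z|} ->
  exists t, A \subset facet t /\ ascending t.
Proof.
move=> chA selA; have [t [Ht tie]] := refining_perm (fun a => a : nat) chA.
exists t; split.
  by apply/subsetP => z zA; rewrite (Ht z zA); apply: mem_facet; exact: selA.
apply/ascendingP => a b ab bS; rewrite ltn_neqAle; apply/andP; split.
  by apply/eqP => /val_inj e; rewrite e in ab; lia.
apply: tie => [|z zA]; first by lia.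
rewrite (Ht z zA) !inE.
have : #|z| <> position t b by move=> e; rewrite -e selA in bS.
lia.
Qed.

Lemma same_position_block s t a b : eq_off s t -> position s a = position t b ->
  same_block s a b.
Proof. by move=> st ab; apply/same_blockP => j jS; rewrite [in RHS]st // !inE ab. Qed.

(** Ascents between blocks survive the rearrangement: a block now ends with its minimum, at most its
    former last letter, and the next one begins with its maximum, at least its former first
    letter. *)
Lemma descending_rearrangement t : ascending t ->
  exists s, [/\ eq_off t s, descending s & ascending s].
Proof.
move=> /ascendingP at_; have sub0 : finset.set0 \subset ear_vertices t by exact: sub0set.
have ch0 : chain_set (finset.set0 : {set {set 'I_r}}) by apply/chain_setP => z w; rewrite inE.
(* Extending the empty chain with the key [r - a] sorts each block decreasingly. *)
have [s [ts _ tie]] := extend_facet (fun a => r - a) sub0 ch0.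
have st := eq_off_sym ts.
have key a b : position s a < position s b -> same_block s a b -> b < a.
  move=> ab bl; have := tie a b ab bl (fun z => ltac:(by rewrite inE)).
  have : (a : nat) != b by apply: contraTneq ab => /val_inj ->; rewrite ltnn.
  have := ltn_ord a; have := ltn_ord b; rewrite leEnat; lia.
have ds : descending s.
  move=> a b ab bS; apply: key; first by lia.
  apply/same_block_position; first by lia.
  by move=> j jab; have -> : j = position s b by lia.
exists s; split=> //; apply/ascendingP => a b ab bS.
have [a' a't] := letter_at t (position_lt s a).
have [b' b't] := letter_at t (position_lt s b).
have bla := same_position_block st (esym a't).
have blb := same_position_block st (esym b't).
have a'b' : a' < b' by apply: at_; rewrite ?a't ?b't.
have a'k : a' \in prefix_set s (position s b) by rewrite st // inE a't; lia.
have b'k : b' \notin prefix_set s (position s b) by rewrite st // inE b't ltnn.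
have aa' : a <= a'.
  have [-> //|ne] := eqVneq a' a.
  have lt : position s a' < position s a.
    have : position s a' != position s a by apply: contra ne => /eqP/position_inj ->.
    by move: a'k; rewrite inE; lia.
  by apply/ltnW/key; rewrite // same_block_sym.
have bb' : b' <= b.
  have [-> //|ne] := eqVneq b' b.
  have lt : position s b < position s b'.
    have : position s b' != position s b by apply: contra ne => /eqP/position_inj ->.
    by move: b'k; rewrite inE; lia.
  by apply/ltnW/key.
lia.
Qed.

Lemma facet_inj s t : eq_off s t -> facet s = facet t -> s = t.
Proof.
move=> st e; have H j : prefix_set s j = prefix_set t j.
  have [jS|/st //] := boolP (selected j).
  have := mem_facet s jS; rewrite e => /mem_facet_card[_].
  by rewrite card_prefix_set ?selected_le.
apply: position_inj2 => a; apply/eqP; rewrite eqn_leq; apply/andP; split.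
  by have /setP/(_ a) := H (position t a).+1; rewrite !inE !ltnS leqnn.
by have /setP/(_ a) := H (position s a).+1; rewrite !inE !ltnS leqnn => <-.
Qed.

Lemma facet_maximal s t A : A \subset ear_vertices s -> chain_set A ->
  facet t \subset A -> A = facet t.
Proof.
move=> As chA tA; have [u [_ Au _]] := extend_facet (fun a => a : nat) As chA.
by apply/esym/eqP; rewrite eqEcard tA card_facet -(card_facet u) subset_leq_card.
Qed.

(** The blocks of [s] and [t] coincide, so [g] precedes [h] in [t] as well and [t] has a descent
    between them. As [t] is ascending, this descent has a selected rank, and the prefix set there
    separates the two letters. *)
Lemma ascending_separating s t : eq_off s t -> ascending t -> separating (facet t) s.
Proof.
move=> st /ascendingP at_ g h hg [j jS]; rewrite st // !inE => /andP[gj hj].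
have [|c [d [cd dc gd]]] := descent_between (_ : position t g < position t h) hg; first lia.
have dS : selected (position t d).
  by apply: contraT => /(at_ _ _ cd); lia.
exists (prefix_set t (position t d)); rewrite ?mem_facet // !inE; lia.
Qed.

Definition agree_except k t u := forall j, j <> k -> prefix_set t j = prefix_set u j.

Lemma agree_except_lt k t u c j : agree_except k t u -> j <> k ->
  (position t c < j) = (position u c < j).
Proof. by move=> tu /tu /setP/(_ c); rewrite !inE. Qed.

(** An interval of length two in a Boolean lattice has just two middle elements: only the letters at
    positions [k.-1] and [k] can trade places, and for [k = 0] or [r <= k] nothing can move. *)
Lemma agree_except_unique k t u v : agree_except k t u -> agree_except k t v ->
  [\/ u = t, v = t | u = v].
Proof.
move=> tu tv.
have H (w : 'S_r) c : agree_except k t w -> position t c <> k.-1 -> position t c <> k ->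
    position w c = position t c.
  move=> tw c1 c2; have := agree_except_lt c tw (j := position t c).
  have := agree_except_lt c tw (j := (position t c).+1); lia.
have [k0|k0] := posnP k.
  apply: Or31; apply: position_inj2 => c.
  have := agree_except_lt c tu (j := position t c).
  have := agree_except_lt c tu (j := (position t c).+1); lia.
have [rk|kr] := leqP r k.
  apply: Or31; apply: position_inj2 => c; have := position_lt t c; have := position_lt u c.
  have := agree_except_lt c tu (j := position t c).
  have := agree_except_lt c tu (j := (position t c).+1); lia.
have [b bk] := letter_at t kr; have [a ak] := letter_at t (leq_ltn_trans (leq_pred k) kr).
have ab : a <> b by move=> e; rewrite e in ak; lia.
have K (w : 'S_r) : agree_except k t w -> position w a = k.-1 /\ position w b = k \/
    position w a = k /\ position w b = k.-1.
  move=> tw; have nab : position w a <> position w b by move/position_inj.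
  have := agree_except_lt a tw (j := k.-1); have := agree_except_lt a tw (j := k.+1).
  have := agree_except_lt b tw (j := k.-1); have := agree_except_lt b tw (j := k.+1); lia.
have E (w x : 'S_r) : agree_except k t w -> agree_except k t x ->
    position w a = position x a -> position w b = position x b -> w = x.
  move=> tw tx wa wb; apply: position_inj2 => c.
  have [e|c1] := eqVneq (position t c) k.-1; first by rewrite (position_inj (etrans e (esym ak))).
  have [e|c2] := eqVneq (position t c) k; first by rewrite (position_inj (etrans e (esym bk))).
  by rewrite (H w) ?(H x) //; exact/eqP.
have tt : agree_except k t t by [].
case: (K u tu) => -[ua ub]; first by apply: Or31; apply: E; rewrite ?ua ?ub.
case: (K v tv) => -[va vb]; first by apply: Or32; apply: E; rewrite ?va ?vb.
by apply: Or33; apply: E; rewrite ?ua ?ub.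
Qed.

Lemma agree_except_eq_off k t u : selected k -> agree_except k t u -> eq_off t u.
Proof. by move=> kS tu j jS; apply: tu => e; rewrite e kS in jS. Qed.

Lemma agree_except_facet k t u : agree_except k t u ->
  facet t :\ prefix_set t k \subset facet u.
Proof.
move=> tu; apply/subsetP => z; rewrite in_setD1 => /andP[zk /facetP[j jS zj]].
rewrite zj tu ?mem_facet // => e; by rewrite zj e eqxx in zk.
Qed.

Lemma facet_agree_except k t u : eq_off t u ->
  facet t :\ prefix_set t k \subset facet u -> agree_except k t u.
Proof.
move=> tu /subsetP H j jk; have [jS|/tu //] := boolP (selected j).
have jr := selected_le jS.
have /H/mem_facet_card[] : prefix_set t j \in facet t :\ prefix_set t k.
  rewrite in_setD1 mem_facet // andbT; have [kr|rk] := leqP k r.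
    apply/eqP => /(congr1 (fun z : {set _} => #|z|)).
    by rewrite !card_prefix_set.
  have := selected_bounds jS => /andP[_ jr'].
  apply/eqP => /(congr1 (fun z : {set _} => #|z|)).
  by rewrite (prefix_set_ge t (ltnW rk)) cardsT card_ord card_prefix_set //; lia.
by rewrite card_prefix_set.
Qed.

Lemma position_swap t a b c :
  position (t * tperm a b)%g c = position t (tperm a b c).
Proof. by rewrite /position invMg tpermV permM. Qed.

Lemma swap_agree_except t a b : (position t a).+1 = position t b ->
  agree_except (position t b) t (t * tperm a b)%g.
Proof.
move=> ab j jb; apply/setP => c; rewrite !inE position_swap.
by case: tpermP => [->|->|//]; lia.
Qed.

(** Termination measure for exchanges at descents: moving the larger letter to the right increases
    it, and it is bounded by the sum of all [a * r]. *)
Let inv_weight t := \sum_(a : 'I_r) a * position t a.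

Lemma swap_weight t a b : (position t a).+1 = position t b -> b < a ->
  inv_weight t < inv_weight (t * tperm a b)%g.
Proof.
move=> ab ba; have nab : b != a by apply: contraTneq ba => ->; rewrite ltnn.
rewrite /inv_weight (bigD1 a) // (bigD1 b) //= [X in _ < X](bigD1 a) //.
rewrite [X in _ < _ + X](bigD1 b) //=.
rewrite [X in _ < _ + (_ + X)](eq_bigr (fun c : 'I_r => c * position t c)).
  by rewrite !position_swap tpermL tpermR -ab; nia.
by move=> c /andP[ca cb]; rewrite position_swap tpermD // eq_sym.
Qed.

(** Descents whose prefix set is not in [A] are exchanged one after the other. If every result were
    ascending, the process would end with a permutation whose descents all have their prefix sets in
    [A], and [A] would be separating. The exchange that first fails to be ascending gives [u], [v]
    and [k]. *)
Lemma boundary_pair s A t : eq_off s t -> A \subset facet t -> ascending t ->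
  ~ separating A s ->
  exists u v k, [/\ [/\ eq_off s u, ascending u & A \subset facet u],
    [/\ eq_off s v, ~~ ascending v & A \subset facet v],
    selected k, agree_except k u v & prefix_set u k \notin A].
Proof.
move=> + + + nsep; have [n le_n] := ubnP (\sum_(a : 'I_r) a * r - inv_weight t).
elim: n t le_n => // n IH t le_n st At at_.
have [/existsP[a /existsP[b /and3P[/eqP ab ba nA]]]|none] := boolP
    [exists a, exists b, [&& (position t a).+1 == position t b, b < a &
       prefix_set t (position t b) \notin A]]; last first.
  case: nsep => g h hg [j jS]; rewrite st // !inE => /andP[gj hj].
  have gh : position t g < position t h by rewrite (leq_trans gj) // leqNgt.
  have [c [d [cd dc gd]]] := descent_between gh hg.
  exists (prefix_set t (position t d)); last by rewrite !inE; lia.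
  apply: contraR none => nA; apply/existsP; exists c; apply/existsP; exists d.
  by rewrite cd eqxx dc.
(* Descents of an ascending permutation have selected ranks, so the exchange keeps the blocks. *)
have bS : selected (position t b).
  by apply: contraT => bS; have /ascendingP/(_ a b ab bS) := at_; lia.
pose v := (t * tperm a b)%g.
have tv : agree_except (position t b) t v by exact: swap_agree_except.
have sv : eq_off s v by apply: eq_off_trans st (agree_except_eq_off bS tv).
have Av : A \subset facet v.
  apply: subset_trans (agree_except_facet tv); apply/subsetP => z zA.
  by rewrite in_setD1 (subsetP At) // andbT; apply: contraNneq nA => <-.
have [av|nav] := boolP (ascending v); last by exists t, v, (position t b).
apply: (IH v) => //; have := swap_weight ab ba; rewrite -/v.
have : inv_weight v <= \sum_(c : 'I_r) c * r.
  by apply: leq_sum => c _; rewrite leq_mul2l (ltnW (position_lt _ _)) orbT.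
lia.
Qed.

End RankSelection.

(** * Facets and boundaries of the ears *)

Import Order.DefaultSetSubsetOrder Order.DefaultSeqLexiOrder.

Lemma comparable_nested r (z w : {set 'I_r}) : (z >=< w)%O = nested z w.
Proof. by rewrite /Order.comparable !Order.SetSubsetOrder.leEsubset. Qed.

Lemma is_chain_set r (A : {set {set 'I_r}}) : is_chain A = chain_set A.
Proof.
by apply: eq_forallb_in => z zA; apply: eq_forallb_in => w wA; exact: comparable_nested.
Qed.

Lemma label_prefix_set r (c : r.+1.-tuple {set 'I_r}) (s : 'S_r) :
  is_maximal_chain c -> has_label c s -> forall j, tnth c j = prefix_set s j.
Proof.
case/and3P => /eqP c0 _ _ /forallP lab [j jr] /=.
elim: j jr => [|j IH] jr.
  have -> : Ordinal jr = ord0 by apply: val_inj.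
  by rewrite c0 Order.SetSubsetOrder.botEsubset; apply/setP => a; rewrite !inE.
have jr' : j < r by [].
have /andP[_ /eqP] := lab (Ordinal jr'); rewrite /=.
have -> : inord j.+1 = Ordinal jr by apply: val_inj; rewrite /= inordK.
have -> : inord j = Ordinal (ltnW jr) by apply: val_inj; rewrite /= inordK // ltnW.
rewrite IH => ->; apply/setP => a; rewrite !inE [RHS]ltnS [RHS]leq_eqVlt orbC; congr (_ || _).
rewrite /position; apply/eqP/eqP => [->|e]; first by rewrite permK.
have -> : Ordinal jr' = (s^-1)%g a by apply: val_inj.
by rewrite permKV.
Qed.

Lemma card_le_dim1 (T : finType) (K : {set {set T}}) A : A \in K -> #|A| <= dim1 K.
Proof. exact: (@leq_bigmax_cond _ (mem K) (fun A => #|A|)). Qed.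

Section EarFacets.
Variables (r : nat) (S : {set 'I_r.+1}).
Hypothesis hS : forall j : 'I_r.+1, j \in S -> 0 < j < r.
Implicit Types (s t u v : 'S_r) (a b c : 'I_r) (z w : {set 'I_r}) (A F : {set {set 'I_r}}).
Local Notation selected := (selected S).
Local Notation eq_off := (eq_off S).
Local Notation ascending := (ascending S).
Local Notation descending := (descending S).
Local Notation separating := (separating S).
Local Notation facet := (facet S).

Lemma perm_chain_maximal s : is_maximal_chain (perm_chain s).
Proof. by have /andP[] := xchooseP (perm_chain_subproof s). Qed.

Lemma tnth_perm_chain s j : tnth (perm_chain s) j = prefix_set s j.
Proof. by apply: label_prefix_set; have /andP[] := xchooseP (perm_chain_subproof s). Qed.

Lemma maximal_chain_nested (c : r.+1.-tuple {set 'I_r}) i j :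
  is_maximal_chain c -> nested (tnth c i) (tnth c j).
Proof.
case/and3P => _ _; rewrite lt_sorted_uniq_le le_sorted_pairwise => /andP[_ pw].
rewrite -comparable_nested.
wlog ij : i j / i <= j => [H|].
  by case/orP: (leq_total i j) => /H //; rewrite comparable_sym.
apply/le_comparable; rewrite !(tnth_nth finset.set0).
move/(pairwiseP finset.set0): pw => pw.
move: ij; rewrite leq_eqVlt => /orP[/eqP -> //|ij].
by apply: pw; rewrite ?inE ?size_tuple.
Qed.

Lemma ear_subposetE s : ear_subposet S (perm_chain s) = ear_vertices S s.
Proof.
apply/setP => z; apply/setIdP/(ear_verticesP S) => [[]|[zS zs]].
  rewrite inE => zS /exists_inP[c + /tnthP[i zi]].
  case/setIdP => cm /forallP agr; split=> // j.
  case: (ltnP j r.+1) => [jr|/ltnW rj _].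
    rewrite (selected_ord _ (Ordinal jr)) => jS.
    have /implyP/(_ jS)/eqP := agr (Ordinal jr).
    by rewrite tnth_perm_chain /= => <-; rewrite zi maximal_chain_nested.
  by rewrite (prefix_set_ge _ rj) /nested finset.subsetT.
have zs1 : [set z]%SET \subset ear_vertices S s.
  by rewrite sub1set; apply/ear_verticesP.
have ch1 : chain_set [set z]%SET.
  by apply/chain_setP => x y; rewrite !inE => /eqP -> /eqP ->; rewrite /nested subxx.
have [t [st zt _]] := extend_facet (fun a : 'I_r => a : nat) zs1 ch1.
split; first by rewrite inE.
apply/exists_inP; exists (perm_chain t).
  rewrite inE perm_chain_maximal; apply/forallP => j; apply/implyP => jS.
  by rewrite !tnth_perm_chain st // selected_ord.
move: zt; rewrite sub1set => /imsetP[j _ ->].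
by rewrite -tnth_perm_chain mem_tnth.
Qed.

Lemma maximal_chains_ear s F : F \in maximal_chains (ear_subposet S (perm_chain s)) ->
  exists2 t, eq_off s t & F = facet t.
Proof.
rewrite inE ear_subposetE => /maxsetP[/andP[Fs]]; rewrite is_chain_set => chF maxF.
have [t [st Ft _]] := extend_facet (fun a : 'I_r => a : nat) Fs chF.
by exists t => //; rewrite -[LHS](maxF (facet t)) // is_chain_set (facet_sub hS st) facet_chain.
Qed.

Lemma facet_maximal_chain s t : eq_off s t ->
  facet t \in maximal_chains (ear_subposet S (perm_chain s)).
Proof.
move=> st; rewrite inE ear_subposetE; apply/maxsetP; split.
  by rewrite is_chain_set (facet_sub hS st) facet_chain.
by move=> G /andP[Gs]; rewrite is_chain_set => chG tG; apply: facet_maximal Gs chG tG.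
Qed.

Lemma nth_word_position s a : nth 0 (word s) (position s a) = a.
Proof. exact: nth_word. Qed.

Lemma descentE s a b : (position s a).+1 = position s b ->
  (inord (position s b) \in descent_set s) = (b < a).
Proof.
move=> ab; have br := position_lt s b.
rewrite inE inordK; last exact: ltnW.
have -> : (position s b).-1 = position s a by rewrite -ab.
by rewrite !nth_word_position br andbT -ab.
Qed.

Lemma descent_setP s : reflect (ascending s /\ descending s) (descent_set s == S).
Proof.
have selE a b : (position s a).+1 = position s b ->
    selected (position s b) = (inord (position s b) \in S).
  by move=> ab; rewrite -selected_ord inordK // ltnW // ltnS position_lt.
apply: (iffP eqP) => [sS|[/ascendingP as_ ds]].
  split; first (apply/ascendingP => a b ab); last move=> a b ab;
    rewrite (selE a b ab) -[in X in _ \in X]sS (descentE ab) //.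
  rewrite -leqNgt leq_eqVlt => /orP[/eqP/val_inj e|//].
  by rewrite e in ab; have := n_Sn (position s b); rewrite ab.
apply/setP => i; have [/andP[i0 ir]|ir] := boolP (0 < i < r); last first.
  rewrite inE (negPf ir) /=; apply/esym; apply: contraNF ir; exact: hS.
have [b bi] := letter_at s ir; have [a ai] := letter_at s (leq_ltn_trans (leq_pred i) ir).
have ab : (position s a).+1 = position s b by rewrite ai bi prednK.
have iE : i = inord (position s b) by rewrite bi inord_val.
rewrite iE (descentE ab) -(selE _ _ ab); apply/idP/idP => [ba|]; last exact: ds.
by apply: contraTT ba => /(as_ a b ab); rewrite -leqNgt => /ltnW.
Qed.

Local Notation perms := (perms_with_descents S).
Local Notation nth_perm i := (nth 1%g perms i).

Lemma mem_perms s : reflect (ascending s /\ descending s) (s \in perms).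
Proof. by rewrite mem_sort mem_enum inE; exact: descent_setP. Qed.

Lemma nth_permP i : i < size perms ->
  ascending (nth_perm i) /\ descending (nth_perm i).
Proof. by move=> ip; apply/mem_perms/mem_nth. Qed.

Lemma nth_perm_le i j : i <= j -> j < size perms ->
  (word (nth_perm i) <= word (nth_perm j))%O.
Proof.
move=> ij jp; apply: (sorted_leq_nth (leT := fun s t => (word s <= word t)%O)) => //.
- by move=> x y z; exact: le_trans.
- apply: sort_sorted => x y; exact: le_total.
- exact: leq_ltn_trans jp.
Qed.

Lemma word_inj : injective (@word r).
Proof.
move=> s t st; apply/permP => i; apply/val_inj.
have := nth_word_position s (s i); have := nth_word_position t (t i).
by rewrite /position !permK st => -> .
Qed.

Lemma nth_perm_inj i j : i < size perms -> j < size perms ->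
  nth_perm i = nth_perm j -> i = j.
Proof.
move=> ip jp /eqP; rewrite nth_uniq // => [/eqP //|].
by rewrite sort_uniq enum_uniq.
Qed.

(** [separating_word_le] compares the words of the two permutations; as the list is sorted without
    repetitions, this compares their indices. *)
Lemma separating_first i j A : i < size perms -> j < size perms ->
  separating A (nth_perm i) -> A \subset ear_vertices S (nth_perm j) -> i <= j.
Proof.
move=> ip jp sep Aj; have [_ di] := nth_permP ip; have [_ dj] := nth_permP jp.
rewrite leqNgt; apply/negP => ji.
have le_ij : (word (nth_perm i) <= word (nth_perm j))%O.
  apply: (separating_word_le hS di dj sep) => z k /(subsetP Aj)/ear_verticesP[_ H]; exact: H.
have /word_inj/nth_perm_inj : word (nth_perm i) = word (nth_perm j).
  by apply/eqP; rewrite eq_le le_ij nth_perm_le // ltnW.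
by move=> /(_ ip jp) e; rewrite e ltnn in ji.
Qed.

(** The blockwise decreasing rearrangement of [t] has descent set exactly [S], so it occurs in the
    list. *)
Lemma facet_ear t A : A \subset facet t -> ascending t ->
  exists2 i, i < size perms & eq_off (nth_perm i) t.
Proof.
move=> At at_; have [s [ts ds as_]] := descending_rearrangement at_.
have sp : s \in perms by apply/mem_perms.
by exists (index s perms); rewrite ?index_mem // nth_index //; exact: eq_off_sym.
Qed.

Lemma ear_facetsP i F : i < size perms ->
  reflect (exists t, [/\ eq_off (nth_perm i) t, ascending t & F = facet t])
    (F \in ear_facets S i).
Proof.
move=> ip; rewrite /ear_facets /nth_maximal_chains; apply: (iffP setDP).
  case=> /maximal_chains_ear[t st Ft] /bigcupP nF; exists t; split=> //.
  have selF : {in F, forall z, selected #|z|}.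
    by move=> z; rewrite Ft => /(mem_facet_card hS)[].
  have chF : chain_set F by rewrite Ft; exact: facet_chain.
  (* The increasing completion [u] of [F] has the blocks of some [j]-th permutation. Separation
     gives [j <= i], and [j < i] contradicts that [F] is new; so [u] has the blocks and the facet of
     [t], hence equals it. *)
  have [u [Fu au]] := extend_ascending chF selF.
  have FuE : F = facet u by apply/eqP; rewrite eqEcard Fu Ft !card_facet /=.
  have [j jp su] := facet_ear Fu au.
  have ji : j <= i.
    apply: (@separating_first _ _ (facet u)) => //; first exact: ascending_separating.
    by rewrite -FuE Ft facet_sub.
  have [e|ne] := eqVneq j i.
    rewrite e in su; rewrite (facet_inj hS (eq_off_trans (eq_off_sym st) su)) //.
    by rewrite -Ft.
  have lt_ji : j < i by rewrite ltn_neqAle ne.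
  case: nF; exists (Ordinal lt_ji) => //.
  by rewrite FuE facet_maximal_chain.
case=> t [st at_ ->]; split; first exact: facet_maximal_chain.
(* The facet of an ascending [t] is separating for the [i]-th permutation, so no earlier subposet
   contains it. *)
apply/negP => /bigcupP[[j ji] _ /= /maximal_chains_ear[u su tu]].
have jp : j < size perms by exact: ltn_trans ip.
suff : i <= j by rewrite leqNgt ji.
apply: (@separating_first _ _ (facet t)) => //; first exact: ascending_separating.
by rewrite tu facet_sub.
Qed.

Local Notation Sigma i := (nth finset.set0 (ears S) i).

Lemma size_ears : size (ears S) = size perms.
Proof. by rewrite size_mkseq. Qed.

Lemma earP i A : i < size perms ->
  reflect (exists t, [/\ eq_off (nth_perm i) t, ascending t & A \subset facet t])
    (A \in Sigma i).
Proof.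
move=> ip; rewrite nth_mkseq // inE; apply: (iffP exists_inP).
  by case=> F /(ear_facetsP _ ip)[t [st at_ ->]] At; exists t.
by case=> t [st at_ At]; exists (facet t) => //; apply/ear_facetsP => //; exists t.
Qed.

Lemma facets_ear i F : i < size perms ->
  reflect (exists t, [/\ eq_off (nth_perm i) t, ascending t & F = facet t])
    (F \in facets (Sigma i)).
Proof.
move=> ip; rewrite inE; apply: (iffP maxsetP).
  case=> /(earP _ ip)[t [st at_ Ft]] maxF; exists t; split=> //.
  by apply/esym/maxF => //; apply/earP => //; exists t.
case=> t [st at_ ->]; split; first by apply/earP => //; exists t.
move=> G /(earP _ ip)[u [su au Gu]] tG.
apply/eqP; rewrite eq_sym eqEcard tG /=.
by rewrite (leq_trans (subset_leq_card Gu)) ?card_facet.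
Qed.

Lemma ear_complex i : i < size perms -> simplicial_complex (Sigma i).
Proof.
move=> ip; have [at_ _] := nth_permP ip; apply/andP; split.
  by apply/earP => //; exists (nth_perm i); rewrite sub0set.
apply/forall_inP => A /(earP _ ip)[t [st at' At]].
apply/subsetP => G; rewrite inE => GA; apply/earP => //.
by exists t; split=> //; exact: subset_trans At.
Qed.

Local Notation Delta := (order_complex (rank_selected S)).

Lemma order_complexP A :
  reflect ({in A, forall z, selected #|z|} /\ chain_set A) (A \in Delta).
Proof.
rewrite inE is_chain_set; apply: (iffP andP) => -[H chA]; split=> //.
  by move=> z /(subsetP H); rewrite inE.
by apply/subsetP => z zA; rewrite inE; exact: H.
Qed.

Lemma facet_order_complex t A : A \subset facet t -> A \in Delta.
Proof.
move=> At; apply/order_complexP; split; last exact: chain_setS At (facet_chain _ _).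
by move=> z /(subsetP At)/(mem_facet_card hS)[].
Qed.

Lemma order_complex_simplicial : simplicial_complex Delta.
Proof.
apply/andP; split.
  by apply/order_complexP; split; [move=> z|apply/chain_setP => z]; rewrite inE.
apply/forall_inP => A /order_complexP[selA chA]; apply/subsetP => G; rewrite inE => GA.
apply/order_complexP; split; last exact: chain_setS chA.
by move=> z /(subsetP GA); exact: selA.
Qed.

Lemma order_complex_ear A : A \in Delta ->
  exists2 i, i < size perms & A \in Sigma i.
Proof.
case/order_complexP => selA chA; have [t [At at_]] := extend_ascending chA selA.
have [i ip st] := facet_ear At at_.
by exists i => //; apply/earP => //; exists t.
Qed.

Lemma ear_sub i : i < size perms -> Sigma i \subset Delta.
Proof.
by move=> ip; apply/subsetP => A /(earP _ ip)[t [_ _ At]]; exact: facet_order_complex At.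
Qed.

Lemma size_perms_gt0 : 0 < size perms.
Proof.
have /andP[/order_complex_ear[i ip _] _] := order_complex_simplicial.
exact: leq_ltn_trans ip.
Qed.

Lemma bigcup_ears : \bigcup_(i < size perms) Sigma i = Delta.
Proof.
apply/eqP; rewrite eqEsubset; apply/andP; split.
  by apply/bigcupsP => i _; exact: ear_sub.
by apply/subsetP => A /order_complex_ear[i ip Ai]; apply/bigcupP; exists (Ordinal ip).
Qed.

Lemma dim1_ear i : i < size perms -> dim1 (Sigma i) = #|S|.
Proof.
move=> ip; apply/eqP; rewrite eqn_leq; apply/andP; split.
  apply/bigmax_leqP => A /(earP _ ip)[t [_ _ At]].
  by rewrite -(card_facet S t) subset_leq_card.
have [at_ _] := nth_permP ip.
rewrite -(card_facet S (nth_perm i)); apply: card_le_dim1.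
by apply/earP => //; exists (nth_perm i).
Qed.

Lemma dim1_order_complex : dim1 Delta = #|S|.
Proof.
apply/eqP; rewrite eqn_leq; apply/andP; split; last first.
  rewrite -(dim1_ear size_perms_gt0); apply/bigmax_leqP => A /(subsetP (ear_sub size_perms_gt0)).
  exact: card_le_dim1.
apply/bigmax_leqP => A /order_complex_ear[i ip Ai].
by rewrite -(dim1_ear ip); exact: card_le_dim1.
Qed.

Lemma not_separating i A : i < size perms -> A \in \bigcup_(j < i) Sigma j ->
  ~ separating A (nth_perm i).
Proof.
move=> ip /bigcupP[[j ji] _ /=]; have jp : j < size perms by exact: ltn_trans ip.
case/(earP _ jp) => t [jt _ At] sep.
suff : i <= j by rewrite leqNgt ji.
by apply: separating_first sep _ => //; apply: subset_trans At (facet_sub hS jt).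
Qed.

Lemma ear_boundary_pair i A : i < size perms -> A \in Sigma i ->
  ~ separating A (nth_perm i) ->
  exists u v k, [/\ [/\ eq_off (nth_perm i) u, ascending u & A \subset facet u],
    [/\ eq_off (nth_perm i) v, ~~ ascending v & A \subset facet v],
    selected k, agree_except k u v & prefix_set u k \notin A].
Proof.
move=> ip /(earP _ ip)[t [st at_ At]]; exact: (boundary_pair st At at_).
Qed.

Lemma earlier_ears_boundary i : i < size perms ->
  (\bigcup_(j < i) Sigma j) :&: Sigma i = ball_boundary (Sigma i).
Proof.
move=> ip; apply/setP => A; rewrite inE; apply/andP/idP => [[Aj Ai]|].
  have [u [v [k [[su au Au] [sv av Av] kS uv kA]]]] :=
    ear_boundary_pair ip Ai (not_separating ip Aj).
  (* The face of codimension one is obtained from [facet u] by dropping the member of rank [k]. *)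
  rewrite inE; apply/exists_inP; exists (facet u :\ prefix_set u k); last first.
    apply/subsetP => z zA; rewrite in_setD1 (subsetP Au) // andbT.
    by apply: contraNneq kA => <-.
  rewrite inE; apply/and3P; split.
  - by apply/earP => //; exists u; split=> //; exact: subsetDl.
  - by rewrite dim1_ear // -(card_facet S u) [in eqbRHS](cardsD1 (prefix_set u k)) mem_facet.
  (* Any facet of the ear above this face belongs to an ascending [w] that agrees with [u] except at
     [k]. Then [w] is [u] or [v], and [v] is not ascending. *)
  apply/cards1P; exists (facet u); apply/setP => F; rewrite in_set in_set1.
  apply/andP/eqP => [[/(facets_ear _ ip)[w [sw aw ->]] uw]|->]; last first.
    by split; [apply/facets_ear => //; exists u|exact: subsetDl].
  have uw' := facet_agree_except hS (eq_off_trans (eq_off_sym su) sw) uw.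
  case: (agree_except_unique uv uw') => [e|->//|e].
    by rewrite e au in av.
  by rewrite e aw in av.
rewrite inE => /exists_inP[G]; rewrite inE => /and3P[Gi cardG /cards1P[F FG]] AG.
have [u [su au Gu]] := earP _ ip Gi.
have [k kS kG] : exists2 k, selected k & prefix_set u k \notin G.
  have /subsetPn[z zu zG] : ~~ (facet u \subset G).
    apply/negP => /subset_leq_card.
    by move/eqP: cardG; rewrite dim1_ear // card_facet => <-; rewrite ltnn.
  by case/facetP: zu => k kS zk; exists k; rewrite // -zk.
have [/andP[k0 kr] kr'] := (selected_bounds hS kS, selected_le hS kS).
have [b bk] := letter_at u kr; have [a ak] := letter_at u (leq_ltn_trans (leq_pred k) kr).
have ab : (position u a).+1 = position u b by rewrite ak bk prednK.
(* [v] is the other permutation whose facet contains [G]; were it ascending, [G] would lie in two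
   facets of the ear. *)
have [v [uv vb]] : exists v, agree_except k u v /\ position v b = position u a.
  exists (u * tperm a b)%g; split; first by rewrite -bk; exact: swap_agree_except.
  by rewrite position_swap tpermR.
have sv : eq_off (nth_perm i) v := eq_off_trans su (agree_except_eq_off kS uv).
have Gv : G \subset facet v.
  apply: subset_trans (agree_except_facet S uv); apply/subsetP => z zG.
  by rewrite in_setD1 (subsetP Gu) // andbT; apply: contraNneq kG => <-.
have nav : ~~ ascending v.
  apply/negP => av.
  have H (w : 'S_r) : eq_off (nth_perm i) w -> ascending w -> G \subset facet w -> facet w = F.
    move=> sw aw Gw; apply/set1P; rewrite -FG in_set Gw andbT.
    by apply/facets_ear => //; exists w.
  have e : facet u = facet v := etrans (H u su au Gu) (esym (H v sv av Gv)).
  have uvE : u = v := facet_inj hS (eq_off_trans (eq_off_sym su) sv) e.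
  by move: vb; rewrite -uvE -ab; lia.
(* [facet v] lies in some ear [j]. Separation gives [j <= i], and [j = i] would make [v]
   ascending. *)
have [|j jp /(earP _ jp)[w [jw aw vw]]] := @order_complex_ear (facet v).
  exact: (@facet_order_complex v).
have {}vw : facet v = facet w by apply/eqP; rewrite eqEcard vw !card_facet /=.
have ji : j < i.
  rewrite ltn_neqAle; apply/andP; split; last first.
    apply: (@separating_first _ _ (facet w)) => //; first exact: ascending_separating.
    by rewrite -vw facet_sub.
  apply/eqP => e; rewrite e in jw.
  by move: nav; rewrite (facet_inj hS (eq_off_trans (eq_off_sym sv) jw) vw) aw.
split; last by apply/earP => //; exists u; split=> //; exact: subset_trans AG Gu.
apply/bigcupP; exists (Ordinal ji) => //=; apply/earP => //; exists w; split=> //.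
by rewrite -vw; exact: subset_trans AG Gv.
Qed.

End EarFacets.

(** * Coordinates *)

Local Open Scope ring_scope.

Lemma sum_telescope (V : zmodType) (f : nat -> V) n i j : (i <= j < n)%N ->
  \sum_(k < n | (i < k <= j)%N) (f k.-1 - f k) = f i - f j.
Proof.
case/andP; elim: j => [|j IH].
  rewrite leqn0 => /eqP -> _; rewrite subrr big1 // => k.
  by case/andP => k0; rewrite leqNgt k0.
rewrite leq_eqVlt => /orP[/eqP -> _|ij jn].
  by rewrite subrr big1 // => k /andP[k0]; rewrite leqNgt k0.
rewrite (bigD1 (Ordinal jn)) /=; last by rewrite ij leqnn.
rewrite (eq_bigl (fun k : 'I_n => (i < k <= j)%N)).
  by rewrite IH ?(ltnW jn) // addrC addrA subrK.
move=> k; rewrite -val_eqE /=; case: (ltnP i k) => //= _.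
by rewrite [in RHS]leqNgt; lia.
Qed.

Section Coordinates.
Variables (R : realFieldType) (r : nat) (S : {set 'I_r.+1}).
Hypothesis hS : forall j : 'I_r.+1, j \in S -> (0 < j < r)%N.
Implicit Types (s t : 'S_r) (a b : 'I_r) (z w : {set 'I_r}) (y : 'rV[R]_#|S|).
Implicit Types (u : 'I_r -> R).
Local Notation selected := (selected S).
Local Notation eq_off := (eq_off S).
Local Notation same_block := (same_block S).
Local Notation facet := (facet S).
Local Notation rank j := (val (enum_val j) : nat).

(** The sum has at most one term: it reads [u] at the letter in position [k] and is 0 beyond the end
    of the word. *)
Definition at_position s u k : R := \sum_(a | position s a == k) u a.

Lemma at_positionE s u a : at_position s u (position s a) = u a.
Proof.
by rewrite /at_position (big_pred1 a) // => b /=; rewrite (inj_eq (@position_inj _ s)).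
Qed.

(** Coordinates for functions on the letters modulo constants on each block: one for every selected
    rank, namely the drop of [u] across it along the word [s]. [level s] chooses a representative
    ([gaps_level]). *)
Definition gaps s u : 'rV[R]_#|S| :=
  \row_j (at_position s u (rank j).-1 - at_position s u (rank j)).

Definition level_form s a : 'cV[R]_#|S| :=
  \col_j (a \in prefix_set s (rank j))%:R.

Definition level s y a : R := (y *m level_form s a) 0 0.

Lemma levelE s y a : level s y a = \sum_j y 0 j * (a \in prefix_set s (rank j))%:R.
Proof. by rewrite /level mxE; apply: eq_bigr => j _; rewrite mxE. Qed.

Lemma levelD s y y' a : level s (y + y') a = level s y a + level s y' a.
Proof. by rewrite /level mulmxDl mxE. Qed.

Lemma levelZ s k y a : level s (k *: y) a = k * level s y a.
Proof. by rewrite /level -scalemxAl mxE. Qed.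

Lemma level_sum s I (q : seq I) P (F : I -> 'rV[R]_#|S|) a :
  level s (\sum_(i <- q | P i) F i) a = \sum_(i <- q | P i) level s (F i) a.
Proof. by rewrite /level mulmx_suml summxE. Qed.

Lemma rank_selected_val (j : 'I_#|S|) : selected (rank j).
Proof. by rewrite selected_ord enum_valP. Qed.

Lemma rank_letters s (j : 'I_#|S|) : exists a b,
  [/\ position s a = (rank j).-1, position s b = rank j,
    (position s a).+1 = position s b & same_block s a b].
Proof.
have /andP[j0 jr] := hS (enum_valP j).
have [b bj] := letter_at s jr; have [a aj] := letter_at s (leq_ltn_trans (leq_pred _) jr).
have ab : (position s a).+1 = position s b by rewrite aj bj prednK.
exists a, b; split=> //; apply/same_block_position; first by rewrite -ab leqnSn.
move=> k; rewrite ab -eqn_leq => /eqP <-; rewrite bj; exact: rank_selected_val.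
Qed.

(** The drops across the ranks between [a] and [b] telescope. These ranks are all selected because
    the letters share a block. *)
Lemma sum_gaps s t u a b : eq_off s t -> same_block s a b ->
  \sum_j gaps t u 0 j * ((a \in prefix_set t (rank j))%:R - (b \in prefix_set t (rank j))%:R) =
  u a - u b.
Proof.
move=> st; rewrite (same_block_eq_off st).
have wl c d : (position t c <= position t d)%N -> same_block t c d ->
    \sum_j gaps t u 0 j * ((c \in prefix_set t (rank j))%:R - (d \in prefix_set t (rank j))%:R) =
    u c - u d.
  move=> cd /(same_block_position S cd) H.
  rewrite -[u c](at_positionE t) -[u d](at_positionE t).
  rewrite -(sum_telescope (at_position t u) (n := r.+1)); last first.
    by rewrite cd ltnS ltnW // position_lt.
  pose G (k : 'I_r.+1) := (at_position t u k.-1 - at_position t u k) *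
    ((c \in prefix_set t k)%:R - (d \in prefix_set t k)%:R).
  rewrite (eq_bigr (fun j => G (enum_val j))) => [|j _]; last by rewrite mxE.
  rewrite -(big_enum_val (A := mem S) G) big_mkcond [RHS]big_mkcond; apply: eq_bigr => k _.
  rewrite /G !inE -selected_ord.
  have [/andP[ck kd]|nk] := boolP (position t c < k <= position t d)%N.
    by rewrite H ?ck // ltnNge kd subr0 mulr1.
  case: ifP => // _; have [kc|ck] := leqP k (position t c).
    by rewrite ltnNge (leq_trans kc cd) subrr mulr0.
  by rewrite ck /= -ltnNge in nk; rewrite nk subrr mulr0.
have [ab|/ltnW ba] := leqP (position t a) (position t b); first exact: wl.
rewrite same_block_sym => /(wl _ _ ba) e.
by rewrite -[RHS]opprB -e -sumrN; apply: eq_bigr => j _; rewrite -mulrN opprB.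
Qed.

Lemma level_gaps s t u a b : eq_off s t -> same_block s a b ->
  level t (gaps t u) a - level t (gaps t u) b = u a - u b.
Proof.
move=> st ab; rewrite -(sum_gaps u st ab) !levelE -sumrB.
by apply: eq_bigr => j _; rewrite -mulrBr.
Qed.

Lemma gaps_level s y : gaps s (level s y) = y.
Proof.
apply/rowP => j; rewrite mxE; have [a [b [aj bj ab _]]] := rank_letters s j.
rewrite -[in (rank j).-1]aj -[in X in _ - at_position _ _ X]bj !at_positionE !levelE -sumrB.
rewrite (bigD1 j) //= big1 ?addr0 => [|i ij].
  by rewrite !inE bj ltnn -bj -ab leqnn mulr1 mulr0 subr0.
rewrite !inE aj bj -mulrBr; suff -> : ((rank j).-1 < rank i)%N = (rank j < rank i)%N.
  by rewrite subrr mulr0.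
have : rank i != rank j by rewrite (inj_eq val_inj) (inj_eq enum_val_inj).
by move: ab; rewrite aj bj; lia.
Qed.

Lemma eq_gaps s t u v : eq_off s t ->
  (forall a b, same_block s a b -> u a - u b = v a - v b) -> gaps t u = gaps t v.
Proof.
move=> st uv; apply/rowP => j; rewrite !mxE; have [a [b [<- <- _]]] := rank_letters t j.
by rewrite -(same_block_eq_off st) !at_positionE; exact: uv.
Qed.

Lemma level_inj s y y' : (forall a b, same_block s a b ->
  level s y a - level s y b = level s y' a - level s y' b) -> y = y'.
Proof. by move=> H; rewrite -(gaps_level s y) -(gaps_level s y'); apply: (eq_gaps (s := s)). Qed.

Definition ind z a : R := (a \in z)%:R.

Definition ear_dir s z : 'rV[R]_#|S| := gaps s (ind z).

Lemma level_dir s z a b : same_block s a b ->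
  level s (ear_dir s z) a - level s (ear_dir s z) b = ind z a - ind z b.
Proof. exact: level_gaps. Qed.

(** The directions of the members of [facet t] form a basis in which the coordinates are the gaps
    along [t]; uniqueness is [gaps_dir_sum]. The cone over the facet is where all these gaps are
    nonnegative. *)
Lemma dir_sum s t y :  eq_off s t ->
  y = \sum_j gaps t (level s y) 0 j *: ear_dir s (prefix_set t (rank j)).
Proof.
move=> st; apply: (level_inj (s := s)) => a b ab.
rewrite !level_sum -sumrB -(sum_gaps (level s y) st ab); apply: eq_bigr => j _.
by rewrite !levelZ -mulrBr level_dir.
Qed.

Lemma gaps_dir_sum s t (c : 'I_#|S| -> R) : eq_off s t ->
  gaps t (level s (\sum_j c j *: ear_dir s (prefix_set t (rank j)))) = \row_j c j.
Proof.
move=> st; rewrite -[RHS](gaps_level t); apply: (eq_gaps (s := s)) => // a b ab.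
rewrite !level_sum !levelE -!sumrB; apply: eq_bigr => j _.
by rewrite !levelZ -!mulrBr level_dir // mxE.
Qed.

Lemma gaps_ge0 s t u : eq_off s t ->
  (forall a b, same_block s a b -> (position t a < position t b)%N -> u b <= u a) ->
  forall j, 0 <= gaps t u 0 j.
Proof.
move=> st H j; rewrite mxE; have [a [b [<- <- ab sab]]] := rank_letters t j.
rewrite !at_positionE subr_ge0; apply: H; first by rewrite (same_block_eq_off st).
by rewrite ab.
Qed.

End Coordinates.

Lemma dot_sum (R : comNzRingType) (T : finType) n (c : T -> R) (p : T -> 'rV[R]_n) (l : 'cV[R]_n) :
  ((\sum_z c z *: p z) *m l) 0 0 = \sum_z c z * (p z *m l) 0 0.
Proof.
by rewrite mulmx_suml summxE; apply: eq_bigr => z _; rewrite -scalemxAl mxE.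
Qed.

(** * Vertex directions, the cut function and supporting hyperplanes *)

Section EarVectors.
Variables (R : realFieldType) (r : nat) (S : {set 'I_r.+1}).
Hypothesis hS : forall j : 'I_r.+1, j \in S -> (0 < j < r)%N.
Variable s : 'S_r.
Implicit Types (t : 'S_r) (a b : 'I_r) (z w : {set 'I_r}) (y : 'rV[R]_#|S|).
Implicit Types (A B : {set {set 'I_r}}).
Local Notation selected := (selected S).
Local Notation eq_off := (eq_off S).
Local Notation same_block := (same_block S).
Local Notation facet := (facet S).
Local Notation vertices := (ear_vertices S s).
Local Notation rank j := (val (enum_val j) : nat).
Local Notation ear_dir := (ear_dir R S s).
Local Notation dot x l := ((x *m l) 0 0).

(** Levels decrease along [t] inside each block, so [y] is in the cone over [facet t]: these cones
    cover the space. The tie-break by decreasing letters matters in [remedied_sorted_ascending]. *)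
Lemma sorted_facet y : exists2 t, eq_off s t &
  forall a b, (position t a < position t b)%N -> same_block t a b ->
    level s y b < level s y a \/ level s y b = level s y a /\ (b < a)%N.
Proof.
have sub0 : finset.set0 \subset vertices by exact: sub0set.
have ch0 : chain_set (finset.set0 : {set {set 'I_r}}) by apply/chain_setP => z w; rewrite inE.
have [t [st _ tie]] :=
  extend_facet (fun a => (- level s y a, r - a)%N : (R *l nat)%type) sub0 ch0.
exists t => // a b ab bl; have := tie a b ab bl (fun z => ltac:(by rewrite inE)).
rewrite Order.ProdLexiOrder.leEprodlexi /= !lerN2 => /andP[ba /implyP H].
have [e|ne] := eqVneq (level s y b) (level s y a); last by left; rewrite lt_neqAle ne.
right; split=> //; move: H; rewrite e leEnat => /(_ (lexx _)).
have : (a : nat) != b by apply: contraTneq ab => /val_inj ->; rewrite ltnn.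
have := ltn_ord a; have := ltn_ord b; lia.
Qed.

Lemma sorted_gaps y : exists2 t, eq_off s t & forall j, 0 <= gaps S t (level s y) 0 j.
Proof.
have [t st H] := sorted_facet y; exists t => //; apply: (gaps_ge0 hS st) => a b ab lt_ab.
by move: ab; rewrite (same_block_eq_off st) => /(H a b lt_ab)[/ltW|[-> _]].
Qed.

Lemma vertexP B z : B \subset vertices -> chain_set B -> z \in B ->
  exists t (j : 'I_#|S|), [/\ eq_off s t, B \subset facet t & z = prefix_set t (rank j)].
Proof.
move=> Bs chB zB; have [t [st Bt _]] := extend_facet (fun a : 'I_r => a : nat) Bs chB.
have /imsetP[j jS zj] := fintype.subsetP Bt _ zB.
by exists t, (enum_rank_in jS j); rewrite enum_rankK_in.
Qed.

Lemma chain_set1 z : chain_set [set z]%SET.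
Proof. by apply/chain_setP => x w; rewrite !inE => /eqP -> /eqP ->; rewrite /nested subxx. Qed.

Lemma sum_facet (V : zmodType) t (G : {set 'I_r} -> V) :
  \sum_(z in facet t) G z = \sum_(j < #|S|) G (prefix_set t (rank j)).
Proof.
rewrite big_imset /= ?(big_enum_val (A := mem S) (fun k : 'I_r.+1 => G (prefix_set t k))) //.
move=> i j iS jS /(congr1 (fun z : {set _} => #|z|)).
have le_r (k : 'I_r.+1) : (k <= r)%N by have := ltn_ord k.
by rewrite !card_prefix_set // => /val_inj.
Qed.

Lemma dirM z w : ear_dir z + ear_dir w = ear_dir (z :&: w) + ear_dir (z :|: w).
Proof.
apply: (level_inj hS (s := s)) => a b ab; rewrite !levelD.
have dE v := level_dir R v ab.
have : ind R z a + ind R w a - (ind R z b + ind R w b) =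
    ind R (z :&: w) a + ind R (z :|: w) a - (ind R (z :&: w) b + ind R (z :|: w) b).
  by rewrite /ind !inE; do 4!case: (_ \in _); rewrite /=; lra.
by have := (dE z, dE w, dE (z :&: w), dE (z :|: w)); case=> [[[]]]; lra.
Qed.

Lemma dir_prefix_set j : ~~ selected j -> ear_dir (prefix_set s j) = 0.
Proof.
move=> jS; apply: (level_inj hS (s := s)) => a b ab; rewrite level_dir // /ind.
move/same_blockP: ab => -> //; rewrite subrr.
by rewrite /level !mul0mx !mxE subrr.
Qed.

(* The gauge of the polytope takes the value [cut z] at [ear_dir z]. *)
Definition cut z : R :=
  \sum_(p : 'I_r * 'I_r | same_block s p.1 p.2) ((p.1 \in z) && (p.2 \notin z))%:R.

Lemma cut_ge0 z : 0 <= cut z.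
Proof. by apply: sumr_ge0 => p _; rewrite ler0n. Qed.

Lemma cut_gt0 z : z \in vertices -> 0 < cut z.
Proof.
move=> zs; have zs1 : [set z]%SET \subset vertices by rewrite finset.sub1set.
have [t [j [st _ zj]]] := vertexP zs1 (chain_set1 z) (set11 z).
have [a [b [_ bj ab sab]]] := rank_letters hS t j.
rewrite /cut (bigD1 (a, b)) /=; last by rewrite (same_block_eq_off st).
rewrite zj !inE -bj -ab ltnn leqnn ltr_pwDl // sumr_ge0 // => p _; exact: ler0n.
Qed.

(** A fixed member containing [a] but not [b] is comparable to [w], which contains [b], so [w] would
    contain [a]. The other case is symmetric, through [z]. *)
Lemma crossing_same_block z w a b : z \in vertices -> w \in vertices ->
  a \in z -> a \notin w -> b \in w -> b \notin z -> same_block s a b.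
Proof.
move=> /ear_verticesP[_ zs] /ear_verticesP[_ ws] az aw bw bz.
apply/same_blockP => j jS; apply/idP/idP => [aj|bj].
  by apply: contraNT aw => bj; apply: nestedP (ws j jS) bw bj aj.
by apply: contraNT bz => aj; apply: nestedP (zs j jS) az aj bj.
Qed.

(** Strictness comes from the pair [(a, b)], which counts in [cut z] but neither for the
    intersection nor for the union. *)
Lemma cut_submodular z w a b : same_block s a b ->
  a \in z -> a \notin w -> b \in w -> b \notin z ->
  cut (z :&: w) + cut (z :|: w) < cut z + cut w.
Proof.
move=> ab az aw bw bz; rewrite /cut -!big_split /=.
rewrite (bigD1 (a, b)) //= [ltRHS](bigD1 (a, b)) //= !inE az bw (negPf aw) (negPf bz) /=.
rewrite ltr_leD //; first by lra.
apply: ler_sum => p _; rewrite !inE.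
by do 4!case: (_ \in _); rewrite /=; lra.
Qed.

Definition ear_point z : 'rV[R]_#|S| := (cut z)^-1 *: ear_dir z.

(** The empty set contributes the origin ([point0]), so the bound in a supporting inequality is
    never negative. *)
Definition ear_base : {set {set 'I_r}} := finset.set0 |: vertices.

Lemma set0_notin_vertices : finset.set0 \notin vertices.
Proof. by apply/negP => /ear_verticesP[]; rewrite cards0 => /(selected_bounds hS). Qed.

Lemma point0 : ear_point finset.set0 = 0.
Proof.
rewrite /ear_point (_ : finset.set0 = prefix_set s 0) ?dir_prefix_set ?scaler0 //.
  exact: unselected0.
Qed.

Lemma dot_point z (l : 'cV[R]_#|S|) k : z \in vertices ->
  (dot (ear_point z) l <= k) = (dot (ear_dir z) l <= k * cut z).
Proof. by move=> zs; rewrite -scalemxAl mxE mulrC ler_pdivrMr ?cut_gt0. Qed.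

Lemma dot_point_eq z (l : 'cV[R]_#|S|) k : z \in vertices ->
  (dot (ear_point z) l == k) = (dot (ear_dir z) l == k * cut z).
Proof.
move=> zs; rewrite -scalemxAl mxE mulrC; have := cut_gt0 zs.
by move=> /lt0r_neq0 c0; rewrite (can2_eq (divfK c0) (mulfK c0)).
Qed.

Definition separates B (p : 'I_r * 'I_r) := [exists z in B, (p.1 \in z) && (p.2 \notin z)].

(** The functional that exposes the face of a chain [B]. On [ear_dir z] it is a signed count of the
    separated pairs, hence at most [cut z]. *)
Definition support_form B : 'cV[R]_#|S| :=
  \sum_(p : 'I_r * 'I_r | same_block s p.1 p.2)
     (separates B p)%:R *: (level_form R S s p.1 - level_form R S s p.2).

Lemma dot_support_form B z : dot (ear_dir z) (support_form B) =
  \sum_(p : 'I_r * 'I_r | same_block s p.1 p.2)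
     (separates B p)%:R * ((p.1 \in z)%:R - (p.2 \in z)%:R).
Proof.
rewrite /support_form mulmx_sumr summxE; apply: eq_bigr => p ab.
rewrite -scalemxAr mxE mulmxBr mxE [in X in _ + X]mxE.
by have := level_dir R z ab; rewrite /level /ind => <-.
Qed.

Lemma dot_support_le B z : dot (ear_dir z) (support_form B) <= cut z.
Proof.
rewrite dot_support_form; apply: ler_sum => p _.
by case: (separates B p); do 2!case: (_ \in _); rewrite /=; lra.
Qed.

Lemma dot_support_eq B z : B \subset vertices -> chain_set B -> z \in vertices ->
  (dot (ear_dir z) (support_form B) == cut z) = (z \in B).
Proof.
move=> Bs chB zs; move/chain_setP: (chB) => chBP; apply/eqP/idP => [e|zB]; last first.
  rewrite dot_support_form; apply: eq_bigr => p _.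
  have [sep|nsep] := boolP (separates B p); last first.
    rewrite mul0r; case H: (_ && _) => //.
    by case/negP: nsep; apply/exists_inP; exists z.
  have [w wB /andP[p1 p2]] := exists_inP sep; rewrite mul1r.
  have := @nestedP _ w z p.1 p.2 (chBP w z wB zB) p1; rewrite (negPf p2).
  by do 2!case: (_ \in z) => /=; rewrite ?subrr ?subr0 ?sub0r // => /(_ isT isT).
(* Equality leaves no slack: each pair cut by [z] is separated by a member of [B]. *)
have sep a b : same_block s a b -> a \in z -> b \notin z -> separates B (a, b).
  move=> ab az bz; apply: contraT => nsep; move/eqP: e; rewrite lt_eqF //.
  rewrite dot_support_form /cut (bigD1 (a, b)) //= [ltRHS](bigD1 (a, b)) //=.
  rewrite (negPf nsep) az bz mul0r ltr_leD ?ltr01 //; apply: ler_sum => p _.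
  by case: (separates B p); do 2!case: (_ \in _); rewrite /=; lra.
(* If [z] and [w] crossed, they would yield a pair cut by [z], and the member of [B] separating it
   would cross [w]. *)
have nest : {in B, forall w, nested z w}.
  move=> w wB; apply: contraT; rewrite negb_or => /andP[].
  move=> /subsetPn[a az aw] /subsetPn[b bw bz].
  have ws := fintype.subsetP Bs w wB.
  have /exists_inP[v vB /andP[av bv]] := sep a b (crossing_same_block zs ws az aw bw bz) az bz.
  by rewrite /= (nestedP (chBP v w vB wB) av aw bw) in bv.
have zBs : z |: B \subset vertices by rewrite finset.subUset finset.sub1set zs.
have chzB : chain_set (z |: B).
  apply/chain_setP => v w; rewrite !inE => /predU1P[->|vB] /predU1P[->|wB].
  - by rewrite /nested subxx.
  - exact: nest.
  - by rewrite nested_sym nest.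
  - exact: chBP.
(* In a facet through [z] and [B], take the letters [a] and [b] on either side of the rank of [z].
   Only the member of that rank separates them, so it is in [B]. *)
have [t [j [st Bt zj]]] := vertexP zBs chzB (setU11 z B).
have [a [b [_ bj ab sab]]] := rank_letters hS t j.
have /exists_inP[w wB /= /andP[aw bw]] : separates B (a, b).
  apply: sep; rewrite ?(same_block_eq_off st) // zj !inE -bj -ab ?ltnn ?leqnn //.
have /facetP[k kS wk] : w \in facet t by apply: (fintype.subsetP Bt); rewrite inE wB orbT.
suff kj : k = rank j by rewrite zj -kj -wk.
by move: aw bw; rewrite wk !inE -bj; lia.
Qed.

(** By modularity the values of [l] at the intersection and the union add up to [k] times
    [cut z + cut w], while each is at most [k] times its own cut. Strict submodularity excludes
    [k > 0]. *)
Lemma supporting_crossing (l : 'cV[R]_#|S|) k z w :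
  (forall x, x \in ear_base -> dot (ear_point x) l <= k) ->
  z \in vertices -> w \in vertices -> ~~ nested z w ->
  dot (ear_point z) l = k -> dot (ear_point w) l = k -> k = 0.
Proof.
move=> lk zs ws nzw /eqP; rewrite dot_point_eq // => /eqP ez /eqP.
rewrite dot_point_eq // => /eqP ew.
have k0 : 0 <= k by have := lk finset.set0 (setU11 _ _); rewrite point0 mul0mx mxE.
have nestX (op : {set 'I_r} -> {set 'I_r} -> {set 'I_r}) :
    (forall X, nested z X -> nested w X -> nested (op z w) X) ->
    dot (ear_dir (op z w)) l <= k * cut (op z w).
  move=> H; have nest j : ~~ selected j -> nested (op z w) (prefix_set s j).
    by move=> jS; case/ear_verticesP: zs => _ zs; case/ear_verticesP: ws => _ ws; auto.
  have [oS|oS] := boolP (selected #|op z w|).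
    have os : op z w \in vertices by apply/ear_verticesP.
    by rewrite -dot_point // lk // inE os orbT.
  (* A set of unselected size nested with the fixed member of that size equals it, and fixed members
     have direction zero. *)
  rewrite (nested_card (nest _ oS)).
    by rewrite dir_prefix_set // mul0mx mxE mulr_ge0 // cut_ge0.
  by rewrite card_prefix_set // -[X in (_ <= X)%N]card_ord max_card.
have hI : dot (ear_dir (z :&: w)) l <= k * cut (z :&: w).
  have := nestX (fun x x' => x :&: x'); apply => X /orP[zX|Xz] /orP[wX|Xw]; apply/orP.
  - by left; rewrite subIset ?zX.
  - by left; rewrite subIset ?zX.
  - by left; rewrite subIset ?wX ?orbT.
  - by right; rewrite finset.subsetI Xz.
have hU : dot (ear_dir (z :|: w)) l <= k * cut (z :|: w).
  have := nestX (fun x x' => x :|: x'); apply => X /orP[zX|Xz] /orP[wX|Xw]; apply/orP.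
  - by left; rewrite finset.subUset zX.
  - by right; rewrite subsetU ?Xw ?orbT.
  - by right; rewrite subsetU ?Xz.
  - by right; rewrite subsetU ?Xz.
move: nzw; rewrite negb_or => /andP[/subsetPn[a az aw] /subsetPn[b bw bz]].
have lt := cut_submodular (crossing_same_block zs ws az aw bw bz) az aw bw bz.
have := dirM z w => /(congr1 (fun x => dot x l)).
rewrite !mulmxDl mxE [RHS]mxE ez ew => e.
by apply/eqP; rewrite eq_le k0 andbT; nra.
Qed.

(** The cones over the facets cover the space, so [l] is nonpositive at both [y] and [- y]. In other
    words, the origin is an interior point of the hull. *)
Lemma dot_dir_base (l : 'cV[R]_#|S|) : (forall x, x \in ear_base -> dot (ear_point x) l <= 0) ->
  forall y, dot y l = 0.
Proof.
move=> l0.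
have le0 y : dot y l <= 0.
  have [t st t0] := sorted_gaps y; rewrite (dir_sum hS y st) dot_sum sumr_le0 // => j _.
  rewrite mulr_ge0_le0 //; have zs : prefix_set t (rank j) \in vertices.
    by apply: (fintype.subsetP (facet_sub hS st)); rewrite mem_facet ?rank_selected_val.
  by have := l0 _ (setU1r finset.set0 zs); rewrite dot_point // mul0r.
move=> y; apply/eqP; rewrite eq_le le0 /=.
by have := le0 (- y); rewrite mulNmx mxE oppr_le0.
Qed.

Lemma point_independent B (c : {set 'I_r} -> R) : B \subset vertices -> chain_set B ->
  \sum_(z in B) c z *: ear_point z = 0 -> forall z, z \in B -> c z = 0.
Proof.
move=> Bs chB c0 z zB; have [t [j [st Bt zj]]] := vertexP Bs chB zB.
pose d w := if w \in B then c w / cut w else 0.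
have : \sum_(i < #|S|) d (prefix_set t (rank i)) *: ear_dir (prefix_set t (rank i)) = 0.
  apply: etrans (esym (sum_facet t (fun w => d w *: ear_dir w))) _; rewrite -[RHS]c0.
  rewrite (big_setID B) /= (setIidPr Bt) [X in _ + X]big1 ?addr0 => [|w]; last first.
    by rewrite inE /d => /andP[/negPf ->]; rewrite scale0r.
  by apply: eq_bigr => w wB; rewrite /d wB scalerA.
move/(congr1 (fun y => gaps S t (level s y))); rewrite gaps_dir_sum //.
move/rowP/(_ j); rewrite mxE -zj /d zB => /eqP; rewrite (_ : _ 0 j = 0) => [|]; last first.
  rewrite mxE /at_position !big1 ?subrr // => a _; by rewrite /level mul0mx mxE.
have cz := cut_gt0 (fintype.subsetP Bs z zB).
by rewrite mulf_eq0 invr_eq0 (gt_eqF cz) orbF => /eqP.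
Qed.

Lemma point_inj : {in vertices &, injective ear_point}.
Proof.
move=> z w zs ws e; have zs1 : [set z]%SET \subset vertices by rewrite finset.sub1set.
have H v : v \in vertices -> (dot (ear_point v) (support_form [set z]%SET) == 1) = (v == z).
  by move=> vs; rewrite dot_point_eq // mul1r dot_support_eq ?chain_set1 // inE.
by have := H w ws; rewrite -e H // eqxx => /esym/eqP.
Qed.

End EarVectors.

(** * Inequalities describing the cone over an ear *)

Section AscendingCone.
Variables (R : realFieldType) (r : nat) (S : {set 'I_r.+1}).
Hypothesis hS : forall j : 'I_r.+1, j \in S -> (0 < j < r)%N.
Variable s : 'S_r.
Implicit Types (t : 'S_r) (a b c : 'I_r) (z w : {set 'I_r}) (y : 'rV[R]_#|S|).
Implicit Types (p q : 'I_r * 'I_r).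
Local Notation selected := (selected S).
Local Notation eq_off := (eq_off S).
Local Notation same_block := (same_block S).
Local Notation ascending := (ascending S).
Local Notation facet := (facet S).
Local Notation vertices := (ear_vertices S s).
Local Notation rank j := (val (enum_val j) : nat).
Local Notation ear_dir := (ear_dir R S s).

(** Exactly one fixed member separates the two letters, and it contains [b]: the block of [c] comes
    right after that of [b]. *)
Definition consecutive_blocks b c := [exists k : 'I_r.+1,
  [&& k \notin S, b \in prefix_set s k, c \notin prefix_set s k &
    [forall j : 'I_r.+1, (j \notin S) && (j != k) ==>
       ((b \in prefix_set s j) == (c \in prefix_set s j))]]].

Lemma consecutive_blocksP b c : reflect
  (exists k, [/\ ~~ selected k, b \in prefix_set s k, c \notin prefix_set s k &
     forall j, ~~ selected j -> j <> k -> (b \in prefix_set s j) = (c \in prefix_set s j)])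
  (consecutive_blocks b c).
Proof.
apply: (iffP existsP) => [[k /and4P[kS bk ck /forallP H]]|[k [kS bk ck H]]].
  exists k; split; rewrite ?selected_ord // => j.
  case: (ltnP j r.+1) => [jr|/ltnW rj _ _]; last by rewrite prefix_set_ge ?inE.
  rewrite (selected_ord _ (Ordinal jr)) => jS jk.
  move/implyP: (H (Ordinal jr)) => /(_ _)/eqP; apply; rewrite jS /=.
  by apply/eqP => /(congr1 val).
have kr : (k < r.+1)%N.
  by rewrite ltnNge; apply: contra ck => /ltnW rk; rewrite prefix_set_ge // inE.
exists (Ordinal kr); rewrite -(selected_ord _ (Ordinal kr)) kS bk ck /=.
apply/forallP => j; apply/implyP; rewrite -selected_ord => /andP[jS jk].
by apply/eqP/H => // e; case/eqP: jk; apply: val_inj.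
Qed.

Definition inverted q := ((q.2 : nat) < q.1)%N && consecutive_blocks q.1 q.2.

(* If [q] is inverted, the letters [q.1] and [q.2] cannot end one block and begin
   the next in an ascending permutation.  In a permutation in which [p.2] comes
   before [p.1], for a remedy [p] of [q], they do not. *)
Definition remedy q p :=
  [&& same_block s p.1 p.2, ((p.1 : nat) < p.2)%N & (p.2 == q.1) || (p.1 == q.2)].

(** Let [b0] be the last letter in [t] of the block of [q.1], and [c0] the first letter of the next
    block. As [b0 < c0] and [q.2 < q.1], either [b0 < q.1] or [q.2 < c0], so [(b0, q.1)] or
    [(q.2, c0)] is a remedy. *)
Lemma exists_remedy t q : eq_off s t -> ascending t -> inverted q ->
  exists2 p, remedy q p & (position t p.2 < position t p.1)%N.
Proof.
move=> st /ascendingP at_ /andP[cb /consecutive_blocksP[k [kS bk ck H]]].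
rewrite st // inE in bk; rewrite st // inE in ck.
have ck' : (k <= position t q.2)%N by rewrite leqNgt.
have kr : (k < r)%N := leq_ltn_trans ck' (position_lt _ _).
have [c0 c0k] := letter_at t kr; have [b0 b0k] := letter_at t (leq_ltn_trans (leq_pred k) kr).
have b0c0 : (b0 < c0)%N by apply: at_; rewrite ?c0k ?b0k //; lia.
have P j : ~~ selected j -> j <> k -> (position t q.1 < j)%N = (position t q.2 < j)%N.
  by move=> jS jk; have := H j jS jk; rewrite st // !inE.
have sb : same_block s b0 q.1.
  rewrite (same_block_eq_off st); apply/same_blockP => j jS; rewrite !inE b0k.
  have [->|/eqP jk] := eqVneq j k; [lia|have := P j jS jk; lia].
have sc : same_block s q.2 c0.
  rewrite (same_block_eq_off st); apply/same_blockP => j jS; rewrite !inE c0k.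
  have [->|/eqP jk] := eqVneq j k; [lia|have := P j jS jk; lia].
have [lt_b|le_b] := ltnP b0 q.1.
  exists (b0, q.1); first by rewrite /remedy /= sb lt_b eqxx.
  have : position t q.1 != position t b0.
    by apply: contraTneq lt_b => /position_inj ->; rewrite ltnn.
  by rewrite /= b0k; lia.
have lt_c : (q.2 < c0)%N by lia.
exists (q.2, c0); first by rewrite /remedy /= sc lt_c eqxx orbT.
have : position t q.2 != position t c0.
  by apply: contraTneq lt_c => /position_inj ->; rewrite ltnn.
by rewrite /= c0k; lia.
Qed.

Lemma not_ascending_inverted t : eq_off s t -> ~~ ascending t ->
  exists q, [/\ inverted q, (position t q.1).+1 = position t q.2 &
    ~~ selected (position t q.2)].
Proof.
move=> st /forallPn[b /forallPn[c]]; rewrite negb_imply -leqNgt.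
move=> /andP[/andP[/eqP bc cS] cb]; exists (b, c); split=> //=.
have lt_cb : (c < b)%N.
  rewrite ltn_neqAle cb andbT; apply/eqP => /val_inj e; rewrite e in bc.
  by have := n_Sn (position t b); rewrite bc.
rewrite /inverted /= lt_cb; apply/consecutive_blocksP; exists (position t c).
split=> //; rewrite ?st // ?inE ?ltnn -?bc // => j jS jc.
by rewrite st // !inE; lia.
Qed.

Lemma remedy_position t q p : eq_off s t ->
  (position t q.1).+1 = position t q.2 -> ~~ selected (position t q.2) ->
  remedy q p -> (position t p.1 < position t p.2)%N.
Proof.
move=> st bc cS /and3P[]; rewrite (same_block_eq_off st) => /same_blockP/(_ _ cS).
rewrite !inE => sp lt_p /orP[]/eqP e.
  have : position t p.1 != position t p.2.
    by apply: contraTneq lt_p => /position_inj ->; rewrite ltnn.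
  by move: sp; rewrite e -bc; lia.
have : position t p.2 != position t p.1.
  by apply: contraTneq lt_p => /position_inj ->; rewrite ltnn.
by move: sp; rewrite e -bc; lia.
Qed.

Lemma gaps_mono t y a b : eq_off s t -> (forall j, 0 <= gaps S t (level s y) 0 j) ->
  same_block s a b -> (position t a <= position t b)%N -> level s y b <= level s y a.
Proof.
move=> st g0 ab le_ab; rewrite -subr_ge0 -(sum_gaps (level s y) st ab).
apply: sumr_ge0 => j _; rewrite mulr_ge0 // subr_ge0 ler_nat !inE.
by case: (ltnP (position t b)) => // bj; rewrite (leq_ltn_trans le_ab bj).
Qed.

Lemma ascending_remedied t y : eq_off s t -> ascending t ->
  (forall j, 0 <= gaps S t (level s y) 0 j) ->
  forall q, inverted q -> exists2 p, remedy q p & level s y p.1 <= level s y p.2.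
Proof.
move=> st at_ g0 q /(exists_remedy st at_)[p rp pp]; exists p => //.
case/and3P: rp => sp _ _; apply: (gaps_mono st g0); last exact: ltnW.
by rewrite same_block_sym.
Qed.

(** If the sorted [t] failed to ascend, the offending adjacent letters would be inverted, and their
    remedy [p] would have [p.1] before [p.2]. The two levels would be equal by assumption, but ties
    put the larger letter first and [p.1 < p.2]. With [ascending_remedied], this describes the cone
    over the ear by inequalities. *)
Lemma remedied_sorted_ascending y :
  (forall q, inverted q -> exists2 p, remedy q p & level s y p.1 <= level s y p.2) ->
  exists t, [/\ eq_off s t, ascending t & forall j, 0 <= gaps S t (level s y) 0 j].
Proof.
move=> Hy; have [t st tP] := sorted_facet s y; exists t; split=> //; last first.
  apply: (gaps_ge0 hS st) => a b ab lt_ab.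
  by move: ab; rewrite (same_block_eq_off st) => /(tP a b lt_ab)[/ltW|[-> _]].
apply: contraT => /(not_ascending_inverted st)[q [iq bc cS]].
have [p rp le_p] := Hy q iq; have lt_p := remedy_position st bc cS rp.
case/and3P: rp; rewrite (same_block_eq_off st) => /(tP _ _ lt_p)[|[_ lt21] lt12 _].
  by rewrite ltNge le_p.
by have := ltn_trans lt12 lt21; rewrite ltnn.
Qed.

(** With the next two lemmas: the coefficient of [y] at [z] is the positive part of the minimum of
    [level a - level b] over pairs of a common block with [a] in [z] and [b] outside, a formula
    independent of [t]. *)
Lemma gaps_facet_le t y (j : 'I_#|S|) a b : eq_off s t ->
  (forall j, 0 <= gaps S t (level s y) 0 j) -> same_block s a b ->
  a \in prefix_set t (rank j) -> b \notin prefix_set t (rank j) ->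
  gaps S t (level s y) 0 j <= level s y a - level s y b.
Proof.
move=> st g0 ab aj bj; rewrite -(sum_gaps (level s y) st ab) (bigD1 j) //=.
rewrite aj (negPf bj) subr0 mulr1 lerDl; apply: sumr_ge0 => i _.
rewrite mulr_ge0 // subr_ge0 ler_nat !inE; move: aj bj; rewrite !inE => aj.
rewrite -leqNgt => bj; case: ltnP => // bi.
by rewrite (leq_ltn_trans _ bi) // ltnW // (leq_trans aj).
Qed.

Lemma gaps_facet_attained t y (j : 'I_#|S|) : eq_off s t -> exists p,
  [/\ same_block s p.1 p.2, p.1 \in prefix_set t (rank j), p.2 \notin prefix_set t (rank j) &
     level s y p.1 - level s y p.2 = gaps S t (level s y) 0 j].
Proof.
move=> st; have [a [b [aj bj ab sab]]] := rank_letters hS t j.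
exists (a, b); rewrite /= (same_block_eq_off st); split=> //.
- by rewrite inE -bj -ab.
- by rewrite inE bj ltnn.
- by rewrite mxE -aj -bj !at_positionE.
Qed.

(** If no such pair were in reverse order in [t], then [z] would be an initial segment of [t] and a
    member of its facet. *)
Lemma gaps_off_facet t y z : eq_off s t -> (forall j, 0 <= gaps S t (level s y) 0 j) ->
  z \in vertices -> z \notin facet t -> exists p,
  [/\ same_block s p.1 p.2, p.1 \in z, p.2 \notin z & level s y p.1 - level s y p.2 <= 0].
Proof.
move=> st g0 /ear_verticesP[zS zn] zt.
have [/existsP[p /and4P[sp p1 p2 lt_p]]|none] := boolP [exists p : 'I_r * 'I_r,
    [&& same_block s p.1 p.2, p.1 \in z, p.2 \notin z & (position t p.2 < position t p.1)%N]].
  exists p; split=> //; rewrite subr_le0; apply: (gaps_mono st g0); last exact: ltnW.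
  by rewrite same_block_sym.
case/negP: zt; rewrite (_ : z = prefix_set t #|z|) ?mem_facet //.
apply: initial_prefix_set => a b az bz; rewrite ltnNge leq_eqVlt; apply/negP => /orP[|lt_ba].
  by move=> /eqP/position_inj e; rewrite e az in bz.
case/negP: none; apply/existsP; exists (a, b); rewrite /= az bz lt_ba.
rewrite (_ : same_block s a b) // (same_block_eq_off st); apply/same_blockP => j jS.
apply/idP/idP => [|bj]; first by rewrite !inE; exact: ltn_trans.
apply: contraT => aj; rewrite (nestedP _ az aj bj) in bz => //.
by rewrite -st // zn.
Qed.

Lemma remedy_nonempty q : ascending s -> inverted q -> (0 < #|S|)%N /\ exists p, remedy q p.
Proof.
move=> as_ /(exists_remedy (fun j _ => erefl) as_)[p rp lt_p]; split; last by exists p.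
apply/card_gt0P.
have [sp _ _] := and3P rp; rewrite same_block_sym in sp.
move/(same_block_position S (ltnW lt_p)): sp => /(_ (position s p.1)).
by rewrite lt_p leqnn => /(_ isT)/exists_inP[j jS _]; exists j.
Qed.

End AscendingCone.

From mathcomp Require Import all_classical all_reals topology normedtype realfun.
Import numFieldNormedType.Exports.

(** * The polytopes *)

Section Hulls.
Variables (R : realType) (T : finType) (n : nat).
Implicit Types (p : T -> 'rV[R]_n) (A B : {set T}) (c : T -> R) (l : 'cV[R]_n).
Local Notation dot x l := ((x *m l) 0 0).

(** Weights live on the whole index type and vanish off [A], so hulls of different subsets compare
    without reindexing. *)
Definition hull A p : set 'rV[R]_n := [set x | exists c : T -> R,
  [/\ forall z, 0 <= c z, forall z, z \notin A -> c z = 0, \sum_z c z = 1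
    & x = \sum_z c z *: p z]]%classic.

Lemma hull_sum A c (V : lmodType R) (q : T -> V) : (forall z, z \notin A -> c z = 0) ->
  \sum_z c z *: q z = \sum_(z in A) c z *: q z.
Proof.
move=> c0; rewrite [LHS](bigID (mem A)) /= [X in _ + X]big1 ?addr0 // => z /c0 ->.
by rewrite scale0r.
Qed.

Lemma hull_conv_hull A p :
  hull A p = conv_hull (\matrix_(i < #|A|) p (enum_val i)).
Proof.
apply/seteqP; split=> x /=.
  move=> [c [c0 cA c1 ->]]; exists (\row_i c (enum_val i)); split.
  - by move=> i; rewrite mxE.
  - under eq_bigr do rewrite mxE; rewrite -c1.
    rewrite -(big_enum_val (A := mem A) (fun z => c z)).
    rewrite [RHS](bigID (mem A)) /= [X in _ = _ + X]big1 ?addr0 //.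
  - rewrite (hull_sum _ cA) mulmx_sum_row (big_enum_val (A := mem A) (fun z => c z *: p z)).
    by apply: eq_bigr => i _; rewrite rowK mxE.
move=> [a [a0 a1 ->]].
pose c z := \sum_(i < #|A| | enum_val i == z) a 0 i.
have cE i : c (enum_val i) = a 0 i.
  by rewrite /c (big_pred1 i) // => j /=; rewrite (inj_eq enum_val_inj).
have cA z : z \notin A -> c z = 0.
  by move=> zA; apply: big1 => i /eqP iz; move: zA; rewrite -iz enum_valP.
exists c; split=> //.
- by move=> z; apply: sumr_ge0.
- rewrite -a1 [LHS](bigID (mem A)) /= [X in _ + X]big1 ?addr0 //.
  by rewrite (big_enum_val (A := mem A) (fun z => c z)); apply: eq_bigr => i _; rewrite cE.
- rewrite (hull_sum _ cA) mulmx_sum_row (big_enum_val (A := mem A) (fun z => c z *: p z)).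
  by apply: eq_bigr => i _; rewrite rowK cE.
Qed.

Lemma mem_hull A p z : z \in A -> hull A p (p z).
Proof.
move=> zA; exists (fun w => (w == z)%:R); split=> //.
- by move=> w /=; apply: contraNeq; rewrite pnatr_eq0 eqb0 negbK => /eqP ->.
- by rewrite (bigD1 z) //= eqxx big1 ?addr0 // => w /negPf ->.
- by rewrite (bigD1 z) //= eqxx scale1r big1 ?addr0 // => w /negPf ->; rewrite scale0r.
Qed.

Lemma dot_hull_le A p l (k : R) : (forall z, z \in A -> dot (p z) l <= k) ->
  forall x, hull A p x -> dot x l <= k.
Proof.
move=> pk x [c [c0 cA c1 ->]]; rewrite dot_sum -[k]mul1r -c1 mulr_suml.
apply: ler_sum => z _; have [zA|/cA ->] := boolP (z \in A); last by rewrite !mul0r.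
by rewrite ler_wpM2l ?pk.
Qed.

Lemma dot_hull_eq A p l (k : R) c : (forall z, z \in A -> dot (p z) l <= k) ->
  (forall z, 0 <= c z) -> (forall z, z \notin A -> c z = 0) -> \sum_z c z = 1 ->
  dot (\sum_z c z *: p z) l = k ->
  forall z, c z != 0 -> z \in A /\ dot (p z) l = k.
Proof.
move=> pk c0 cA c1 xk z cz.
have zA : z \in A by apply: contraNT cz => /cA ->.
split=> //; have : \sum_z c z * (k - dot (p z) l) = 0.
  rewrite (eq_bigr (fun z => c z * k - c z * dot (p z) l)) => [|w _]; last by rewrite mulrBr.
  by rewrite sumrB -mulr_suml c1 mul1r -dot_sum xk subrr.
move/eqP; rewrite psumr_eq0 => [/allP/(_ z)|w _].
  by rewrite mem_index_enum mulf_eq0 (negPf cz) subr_eq0 => /(_ isT)/eqP <-.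
have [wA|/cA ->] := boolP (w \in A); last by rewrite mul0r.
by rewrite mulr_ge0 // subr_ge0 pk.
Qed.

Lemma hull_face A p l (k : R) : (forall z, z \in A -> dot (p z) l <= k) ->
  [set x | hull A p x /\ dot x l = k]%classic =
  hull [set z in A | dot (p z) l == k]%SET p.
Proof.
move=> pk; apply/seteqP; split=> x /=.
  move=> [[c [c0 cA c1 ->]] xk]; exists c; split=> // z.
  by apply: contraNeq => /(dot_hull_eq pk c0 cA c1 xk)[zA zk]; rewrite inE zA zk eqxx.
move=> [c [c0 cB c1 ->]]; split.
  by exists c; split=> // z zA; apply: cB; rewrite inE (negPf zA).
rewrite dot_sum -[RHS]mul1r -c1 mulr_suml; apply: eq_bigr => z _.
have [|/cB ->] := boolP (z \in [set z in A | dot (p z) l == k]%SET); last by rewrite !mul0r.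
by rewrite inE => /andP[_ /eqP ->].
Qed.

Lemma hull_vertices A B p : B \subset A ->
  (forall z, z \in B -> face (hull A p) [set p z]%classic) ->
  (polytope_vertices (hull A p) `&` hull B p)%classic = (p @` [set` B])%classic.
Proof.
move=> /fintype.subsetP BA pB; apply/seteqP; split=> x /=; last first.
  by move=> [z zB <-]; split; [exact: pB|exact: mem_hull].
move=> [[l [k [lk xE]]] [c [c0 cB c1 xc]]].
have [z cz] : exists z, c z != 0.
  apply/existsP; apply: contraT; rewrite negb_exists => /forallP H.
  move: c1; rewrite big1 => [/eqP|z _]; first by rewrite eq_sym oner_eq0.
  by apply/eqP; move: (H z); rewrite negbK.
have zB : z \in B by apply: contraNT cz => /cB ->.
have cA w : w \notin A -> c w = 0 by move=> wA; apply: cB; apply: contra wA; exact: BA.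
have pk w : w \in A -> dot (p w) l <= k by move=> wA; apply: lk; exact: mem_hull.
have xk : dot (\sum_w c w *: p w) l = k.
  by rewrite -xc; have : [set x]%classic x by []; rewrite xE => -[].
have [zA zk] := dot_hull_eq pk c0 cA c1 xk cz.
exists z => //; have : [set x]%classic (p z) by rewrite xE; split=> //; exact: mem_hull.
by [].
Qed.

Lemma hull_simplex A p :
  (forall c, \sum_(z in A) c z *: p z = 0 -> forall z, z \in A -> c z = 0) ->
  simplex (hull A p).
Proof.
move=> indep; exists #|A|, (\matrix_(i < #|A|) p (enum_val i)).
split; first exact: hull_conv_hull.
apply: inj_row_free => v; rewrite /homogenize mul_mx_row => /eqP.
rewrite row_mx_eq0 => /andP[/eqP v0 _].
pose c z := \sum_(i < #|A| | enum_val i == z) v 0 i.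
have cE i : c (enum_val i) = v 0 i.
  by rewrite /c (big_pred1 i) // => j /=; rewrite (inj_eq enum_val_inj).
have /indep H : \sum_(z in A) c z *: p z = 0.
  rewrite (big_enum_val (A := mem A) (fun z => c z *: p z)) -[RHS]v0 mulmx_sum_row.
  by apply: eq_bigr => i _; rewrite rowK cE.
by apply/rowP => i; rewrite -cE mxE H ?enum_valP.
Qed.

End Hulls.

(** * The polytope of an ear and its faces *)

Section EarPolytope.
Variables (R : realType) (r : nat) (S : {set 'I_r.+1}).
Hypothesis hS : forall j : 'I_r.+1, j \in S -> (0 < j < r)%N.
Variable s : 'S_r.
Implicit Types (t : 'S_r) (a b : 'I_r) (z w : {set 'I_r}) (y : 'rV[R]_#|S|).
Implicit Types (A B : {set {set 'I_r}}).
Local Notation selected := (selected S).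
Local Notation eq_off := (eq_off S).
Local Notation same_block := (same_block S).
Local Notation facet := (facet S).
Local Notation vertices := (ear_vertices S s).
Local Notation rank j := (val (enum_val j) : nat).
Local Notation ear_point := (ear_point R S s).
Local Notation ear_base := (ear_base S s).
Local Notation cut := (cut R S s).
Local Notation support_form := (support_form R S s).
Local Notation ear_dir := (ear_dir R S s).
Local Notation dot x l := ((x *m l) 0 0).

Definition ear_polytope : set 'rV[R]_#|S| := hull ear_base ear_point.

(** [support_form B] reaches its maximum 1 among the generators exactly at the points of [B]; its
    value 0 at the origin makes the face proper. *)
Lemma chain_proper_face B : B \subset vertices -> chain_set B ->
  proper_face ear_polytope (hull B ear_point).
Proof.
move=> Bs chB; have le1 z : z \in ear_base -> dot (ear_point z) (support_form B) <= 1.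
  rewrite in_setU1 => /predU1P[->|zs]; first by rewrite (point0 R hS) mul0mx mxE ler01.
  by rewrite (dot_point hS) // mul1r dot_support_le.
have FE : hull B ear_point =
    [set x | ear_polytope x /\ dot x (support_form B) = 1]%classic.
  rewrite hull_face //; congr (hull _ _); apply/setP => z; rewrite inE in_setU1.
  have [->|_] /= := eqVneq z finset.set0.
    rewrite (point0 R hS) mul0mx mxE eq_sym oner_eq0; apply/negP => /(fintype.subsetP Bs).
    by rewrite (negPf (set0_notin_vertices hS s)).
  have [zs|nzs] := boolP (z \in vertices); last by apply: contraNF nzs; exact: (fintype.subsetP Bs).
  by rewrite (dot_point_eq hS) // mul1r (dot_support_eq R hS).
split; first by exists (support_form B), 1; split => //; exact: dot_hull_le le1.
rewrite FE => PE; have : ear_polytope (ear_point finset.set0) by apply: mem_hull; rewrite setU11.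
by rewrite -PE /= (point0 R hS) mul0mx mxE => -[_ /esym/eqP]; rewrite oner_eq0.
Qed.

Lemma proper_face_chain F : proper_face ear_polytope F ->
  exists B, [/\ B \subset vertices, chain_set B & F = hull B ear_point].
Proof.
move=> [[l [k [lk FE]]] FP]; pose B := [set z in ear_base | dot (ear_point z) l == k]%SET.
have pk z : z \in ear_base -> dot (ear_point z) l <= k by move=> zb; apply: lk; exact: mem_hull.
have FB : F = hull B ear_point by rewrite FE hull_face.
(* For [k = 0] the functional vanishes identically and the face is the whole polytope. *)
have k0 : k != 0.
  apply: contra_notN FP => /eqP k0; rewrite k0 in pk.
  rewrite FE k0; apply/seteqP; split=> x /= [] //.
  move=> c xP; split; first by exists c.
  exact: (dot_dir_base hS pk).
have Bs : B \subset vertices.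
  apply/fintype.subsetP => z; rewrite inE in_setU1 => /andP[/predU1P[->|//]].
  by rewrite (point0 R hS) mul0mx mxE eq_sym (negPf k0).
exists B; split=> //; apply/chain_setP => z w zB wB; apply: contraT => nzw.
have [zs ws] := (fintype.subsetP Bs z zB, fintype.subsetP Bs w wB).
move: zB wB; rewrite !inE => /andP[_ /eqP ez] /andP[_ /eqP ew].
by rewrite (supporting_crossing hS pk zs ws nzw ez ew) eqxx in k0.
Qed.

Lemma point_vertex z : z \in vertices -> face ear_polytope [set ear_point z]%classic.
Proof.
move=> zs; have zs1 : [set z]%SET \subset vertices by rewrite finset.sub1set.
have [+ _] := chain_proper_face zs1 (chain_set1 z); congr face.
apply/seteqP; split=> x /=; last by move=> ->; apply: mem_hull; rewrite set11.
move=> [c [c0 cA c1 ->]]; move: c1.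
have cz w : w != z -> c w = 0 by move=> wz; apply: cA; rewrite inE.
rewrite (bigD1 z) //= [X in _ + X]big1 // addr0 => c1.
by rewrite (bigD1 z) //= [X in _ + X]big1 ?addr0 ?c1 ?scale1r // => w /cz ->; rewrite scale0r.
Qed.

Lemma ear_polytope_simplicial : simplicial_polytope #|S| ear_polytope.
Proof.
split; last first.
  move=> F /proper_face_chain[B [Bs chB ->]]; apply: hull_simplex => c.
  exact: (point_independent hS).
exists #|ear_base|, (\matrix_(i < #|ear_base|) ear_point (enum_val i)).
split; first exact: hull_conv_hull.
set V := homogenize _.
(* Full dimension: an affine form vanishing at all generators has constant term 0 by its value at
   the origin, and then linear part 0 by [dot_dir_base]. *)
rewrite -mxrank_tr; suff /eqP -> : row_free V^T by rewrite addn1.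
apply: inj_row_free => v /(congr1 trmx); rewrite trmx_mul trmxK trmx0.
rewrite -[v]hsubmxK tr_row_mx /V /homogenize mul_row_col => H.
set v1 := (lsubmx v)^T in H; set v2 := (rsubmx v)^T in H.
have Hz z : z \in ear_base -> dot (ear_point z) v1 + v2 0 0 = 0.
  move=> zb; pose i := enum_rank_in zb z.
  have := congr1 (fun M : 'cV_ _ => M i 0) H; rewrite [LHS]mxE [RHS]mxE => <-.
  congr (_ + _); first rewrite [LHS]mxE [RHS]mxE.
    by apply: eq_bigr => j _; rewrite [in X in _ = X * _]mxE /i enum_rankK_in.
  by rewrite [RHS]mxE big_ord1 [in X in _ = X * _]mxE mul1r.
have v20 : v2 0 0 = 0 by have := Hz _ (setU11 _ _); rewrite (point0 R hS) mul0mx mxE add0r.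
have v10 y : dot y v1 = 0.
  by apply: (dot_dir_base hS) => z /Hz; rewrite v20 addr0 => ->.
have -> : lsubmx v = 0.
  apply/rowP => j; have := v10 (delta_mx 0 j); rewrite -rowE mxE /v1 => e.
  by move: e; rewrite !mxE.
have -> : rsubmx v = 0.
  by apply/rowP => j; rewrite ord1; move: v20; rewrite /v2 !mxE.
by rewrite row_mx0.
Qed.

Lemma ear_boundary_complex :
  relabel ear_point [set A : {set {set 'I_r}} | (A \subset vertices) && chain_set A]%SET =
  boundary_complex ear_polytope.
Proof.
have vE B : B \subset vertices ->
    (polytope_vertices ear_polytope `&` hull B ear_point)%classic = (ear_point @` [set` B])%classic.
  move=> Bs; apply: hull_vertices; first by rewrite subsetU // Bs orbT.
  by move=> z /(fintype.subsetP Bs); exact: point_vertex.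
apply/seteqP; split=> A /=.
  move=> [B]; rewrite /= inE => /andP[Bs chB] <-.
  by exists (hull B ear_point); [exact: chain_proper_face|rewrite vE].
move=> [F /proper_face_chain[B [Bs chB ->]] ->]; exists B; last by rewrite vE.
by rewrite /= inE Bs.
Qed.

End EarPolytope.

(** * The balls *)

Section Continuity.
Variables (R : realType) (T : topologicalType).

Lemma finite_min (I : finType) (P : pred I) (F : I -> T -> R) :
  (exists i, P i) -> (forall i, continuous (F i)) ->
  exists m : T -> R, continuous m /\ forall x,
    (forall i, P i -> m x <= F i x) /\ exists2 i, P i & m x = F i x.
Proof.
move=> [i0 Pi0] Fc.
suff H (q : seq I) : all P q -> exists m : T -> R, continuous m /\ forall x,
    (forall i, i \in i0 :: q -> m x <= F i x) /\ exists2 i, P i & m x = F i x.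
  have [|m [mc mP]] := H [seq i <- enum I | P i].
    by apply/allP => i; rewrite mem_filter => /andP[].
  exists m; split=> // x; have [le_m ex_m] := mP x; split=> // i Pi.
  by apply: le_m; rewrite in_cons mem_filter Pi mem_enum orbT.
elim: q => [|j q IH] /=.
  move=> _; exists (F i0); split=> // x; split; last by exists i0.
  by move=> i; rewrite inE => /eqP ->.
move=> /andP[Pj /IH[m [mc mP]]]; exists (fun x => Num.min (F j x) (m x)); split.
  by move=> x; apply: continuous_min; [exact: Fc|exact: mc].
move=> x; have [le_m [i Pi mi]] := mP x; split.
  move=> k; rewrite !inE ge_min => kq; apply/orP.
  have [->|kj] := eqVneq k j; first by left.
  by right; apply: le_m; move: kq; rewrite (negPf kj) in_cons.
by case: (leP (F j x) (m x)) => _; [exists j|exists i].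
Qed.

Lemma finite_max (I : finType) (P : pred I) (F : I -> T -> R) :
  (exists i, P i) -> (forall i, continuous (F i)) ->
  exists m : T -> R, continuous m /\ forall x,
    (forall i, P i -> F i x <= m x) /\ exists2 i, P i & m x = F i x.
Proof.
move=> exP Fc; have [|m [mc mP]] := @finite_min I P (fun i x => - F i x) exP.
  by move=> i x; apply: cvgN; exact: Fc.
exists (fun x => - m x); split; first by move=> x; apply: cvgN; exact: mc.
move=> x; have [le_m [i Pi mi]] := mP x; split=> [j Pj|]; first by rewrite lerNr le_m.
by exists i; rewrite // mi opprK.
Qed.

Lemma continuous_rV_at n (f : T -> 'rV[R]_n) x :
  (forall j, {for x, continuous (fun y => f y 0 j)}) -> {for x, continuous f}.
Proof.
move=> fc A [P fP PA]; rewrite /= in fP *.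
have H (j : 'I_n) : nbhs x [set y | P 0 j (f y 0 j)]%classic by apply: fc; exact: fP.
have HF : nbhs x [set y | forall j : 'I_n, P 0 j (f y 0 j)]%classic.
  exact: filter_forall.
apply: (@filterS _ (nbhs x) _ _ _ _ HF) => y Py; apply: PA => i j.
by rewrite ord1; exact: Py.
Qed.

Lemma continuous_add_at (f g : T -> R) x : {for x, continuous f} ->
  {for x, continuous g} -> {for x, continuous (fun y => f y + g y)}.
Proof. by move=> fc gc; apply: cvgD; [exact: fc|exact: gc]. Qed.

Lemma continuous_sub_at (f g : T -> R) x : {for x, continuous f} ->
  {for x, continuous g} -> {for x, continuous (fun y => f y - g y)}.
Proof. by move=> fc gc; apply: cvgB; [exact: fc|exact: gc]. Qed.

Lemma continuous_mul_at (f g : T -> R) x : {for x, continuous f} ->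
  {for x, continuous g} -> {for x, continuous (fun y => f y * g y)}.
Proof. by move=> fc gc; apply: cvgM; [exact: fc|exact: gc]. Qed.

Lemma continuous_inv_at (f : T -> R) x : f x != 0 -> {for x, continuous f} ->
  {for x, continuous (fun y => (f y)^-1)}.
Proof. by move=> fx fc; apply: cvgV => //; exact: fc. Qed.

Lemma continuous_sum_at (I : finType) (F : I -> T -> R) x :
  (forall i, {for x, continuous (F i)}) ->
  {for x, continuous (fun y => \sum_i F i y)}.
Proof. by move=> Fc; apply: cvg_big => [|i _]; [exact: add_continuous|exact: Fc]. Qed.

End Continuity.

Lemma continuous_dot (R : realType) n (l : 'cV[R]_n) :
  continuous (fun y : 'rV[R]_n => (y *m l) 0 0).
Proof.
move=> y; have -> : (fun y : 'rV[R]_n => (y *m l) 0 0) = (fun y => \sum_j y 0 j * l j 0).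
  by apply/funext => z; rewrite mxE.
apply: (@continuous_sum_at R 'rV[R]_n) => j.
apply: (@continuous_mul_at R 'rV[R]_n); last exact: cst_continuous.
exact: coord_continuous.
Qed.

(** * A cone that is unbounded along an axis has a ball as its section *)

Section StarShapedCone.
Variables (R : realType) (n : nat) (p : 'rV[R]_n) (j0 : 'I_n).
Hypothesis p_neq0 : p 0 j0 != 0.
Implicit Types (x : 'rV[R]_n.-1) (y : 'rV[R]_n).

Definition eucl m (v : 'rV[R]_m) : R := Num.sqrt (\sum_i v 0 i ^+ 2).

Lemma eucl_ge0 m (v : 'rV[R]_m) : 0 <= eucl v.
Proof. exact: sqrtr_ge0. Qed.

Lemma eucl_eq0 m (v : 'rV[R]_m) : eucl v = 0 -> v = 0.
Proof.
move/eqP; rewrite sqrtr_eq0 => le0; apply/rowP => i; rewrite mxE; apply/eqP.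
rewrite -sqrf_eq0 eq_le sqr_ge0 andbT (le_trans _ le0) // (bigD1 i) //= lerDl.
by apply: sumr_ge0 => j _; exact: sqr_ge0.
Qed.

Lemma eucl0 m : eucl (0 : 'rV[R]_m) = 0.
Proof. by rewrite /eucl big1 ?sqrtr0 // => i _; rewrite mxE expr0n. Qed.

Lemma eucl_le1 m (v : 'rV[R]_m) : (\sum_i v 0 i ^+ 2 <= 1) = (eucl v <= 1).
Proof. by rewrite -(ler_sqrt _ ler01) sqrtr1. Qed.

Lemma euclZ m k (v : 'rV[R]_m) : 0 <= k -> eucl (k *: v) = k * eucl v.
Proof.
move=> k0; rewrite /eucl (eq_bigr (fun i => k ^+ 2 * v 0 i ^+ 2)) => [|i _].
  by rewrite -mulr_sumr sqrtrM ?sqr_ge0 // sqrtr_sqr ger0_norm.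
by rewrite mxE exprMn.
Qed.

Lemma continuous_eucl (T : topologicalType) m (g : T -> 'rV[R]_m) t :
  (forall i, {for t, continuous (fun u => g u 0 i)}) ->
  {for t, continuous (fun u => eucl (g u))}.
Proof.
move=> gc; apply: (@continuous_comp _ _ _ (fun u => \sum_i g u 0 i ^+ 2) Num.sqrt);
  last exact: sqrt_continuous.
by apply: (@continuous_sum_at R T) => i; apply: (@continuous_mul_at R T); exact: gc.
Qed.

(** Projection along [p] to the hyperplane where coordinate [j0] vanishes, with that coordinate
    dropped; [embed] is a section of it. *)
Definition shadow y : 'rV[R]_n.-1 :=
  \row_j (y 0 (lift j0 j) - p 0 (lift j0 j) / p 0 j0 * y 0 j0).

Definition embed x : 'rV[R]_n :=
  \row_i (if unlift j0 i is Some j then x 0 j else 0).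

Lemma shadowZ k y : shadow (k *: y) = k *: shadow y.
Proof. by apply/rowP => j; rewrite !mxE; ring. Qed.

Lemma shadow_embed x t : shadow (embed x + t *: p) = x.
Proof. by apply/rowP => j; rewrite !mxE liftK unlift_none; field. Qed.

Lemma embed_shadow y : y = embed (shadow y) + (y 0 j0 / p 0 j0) *: p.
Proof.
apply/rowP => i; rewrite !mxE; case: unliftP => [j ->|->]; last by field.
by rewrite !mxE; field.
Qed.

Variable psi : 'rV[R]_n -> R.
Hypothesis psi_cont : continuous psi.
Hypothesis psiZ : forall k y, 0 < k -> psi (k *: y) = k * psi y.
Hypothesis psiD : forall t y, psi (y + t *: p) = psi y + t.

Lemma psi0 : psi 0 = 0.
Proof. by have := psiZ 0 (ltr0Sn R 1); rewrite scaler0; lra. Qed.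

(** The fibres of [shadow] are the lines in direction [p], along which [psi] grows with unit
    speed. *)
Lemma shadow_psi_inj y y' : shadow y = shadow y' -> psi y = psi y' -> y = y'.
Proof.
rewrite [in psi y](embed_shadow y) [in psi y'](embed_shadow y') !psiD => e.
by rewrite e => /addrI e'; rewrite (embed_shadow y) (embed_shadow y') e e'.
Qed.

(** Scaling moves [y] to the slice where [eucl (shadow y) + psi y] is 1; there [psi] is nonnegative
    exactly when the shadow lies in the unit ball. *)
Definition cone_to_ball y : 'rV[R]_n.-1 := (eucl (shadow y) + psi y)^-1 *: shadow y.

(** The point of the slice above [x]; the multiple of [p] is chosen to make [psi] equal to
    [1 - eucl x]. *)
Definition ball_to_cone x : 'rV[R]_n := embed x + (1 - eucl x - psi (embed x)) *: p.

Lemma shadow0 : shadow 0 = 0.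
Proof. by apply/rowP => j; rewrite !mxE; ring. Qed.

Lemma cone_norm_gt0 y : 0 <= psi y -> y != 0 -> 0 < eucl (shadow y) + psi y.
Proof.
move=> y0 yn0; rewrite lt_neqAle addr_ge0 ?eucl_ge0 // andbT eq_sym.
apply: contra yn0; rewrite paddr_eq0 ?eucl_ge0 // => /andP[/eqP/eucl_eq0 s0 /eqP p0].
by apply/eqP; apply: shadow_psi_inj; rewrite ?shadow0 ?psi0.
Qed.

Lemma shadow_ball_to_cone x : shadow (ball_to_cone x) = x.
Proof. exact: shadow_embed. Qed.

Lemma psi_ball_to_cone x : psi (ball_to_cone x) = 1 - eucl x.
Proof. by rewrite psiD; ring. Qed.

Lemma ball_to_cone_neq0 x : ball_to_cone x != 0.
Proof.
apply/eqP => e; have := psi_ball_to_cone x; have := shadow_ball_to_cone x.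
by rewrite e shadow0 psi0 => <-; rewrite eucl0; lra.
Qed.

Lemma cone_to_ballZ k y : 0 < k -> cone_to_ball (k *: y) = cone_to_ball y.
Proof.
move=> k0; rewrite /cone_to_ball shadowZ euclZ ?ltW // psiZ // -mulrDr scalerA.
have [->|ne0] := eqVneq (eucl (shadow y) + psi y) 0.
  by rewrite mulr0 invr0 mul0r !scale0r.
by congr (_ *: _); field; rewrite ne0 gt_eqF.
Qed.

Lemma ball_to_coneK x : cone_to_ball (ball_to_cone x) = x.
Proof.
by rewrite /cone_to_ball shadow_ball_to_cone psi_ball_to_cone addrC subrK invr1 scale1r.
Qed.

Lemma cone_to_ballK y : 0 <= psi y -> y != 0 ->
  ball_to_cone (cone_to_ball y) = (eucl (shadow y) + psi y)^-1 *: y.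
Proof.
move=> y0 yn0; have k0 := cone_norm_gt0 y0 yn0.
apply: shadow_psi_inj; first by rewrite shadow_ball_to_cone shadowZ.
rewrite psi_ball_to_cone psiZ ?invr_gt0 // /cone_to_ball euclZ ?invr_ge0 ?ltW //.
by field; rewrite gt_eqF.
Qed.

Lemma cone_to_ball_le1 y : 0 <= psi y -> y != 0 -> eucl (cone_to_ball y) <= 1.
Proof.
move=> y0 yn0; have k0 := cone_norm_gt0 y0 yn0.
rewrite euclZ ?invr_ge0; last exact: ltW.
by rewrite ler_pdivrMl // mulr1 lerDl.
Qed.

Lemma continuous_shadow (j : 'I_n.-1) : continuous (fun y => shadow y 0 j).
Proof.
move=> y; have -> : (fun y => shadow y 0 j) =
    (fun y => y 0 (lift j0 j) - p 0 (lift j0 j) / p 0 j0 * y 0 j0).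
  by apply/funext => z; rewrite mxE.
apply: (@continuous_sub_at R 'rV[R]_n); first exact: coord_continuous.
apply: (@continuous_mul_at R 'rV[R]_n); first exact: cst_continuous.
exact: coord_continuous.
Qed.

Lemma continuous_cone_to_ball y : 0 <= psi y -> y != 0 ->
  {for y, continuous cone_to_ball}.
Proof.
move=> y0 yn0; apply: continuous_rV_at => j.
have -> : (fun y => cone_to_ball y 0 j) =
    (fun y => (eucl (shadow y) + psi y)^-1 * shadow y 0 j).
  by apply/funext => z; rewrite mxE.
apply: (@continuous_mul_at R 'rV[R]_n); last exact: continuous_shadow.
apply: (@continuous_inv_at R 'rV[R]_n); first by rewrite gt_eqF // cone_norm_gt0.
apply: (@continuous_add_at R 'rV[R]_n); last exact: psi_cont.
by apply: continuous_eucl => i; exact: continuous_shadow.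
Qed.

Lemma continuous_embed : continuous embed.
Proof.
move=> x; apply: continuous_rV_at => i.
have -> : (fun x => embed x 0 i) =
    (fun x => if unlift j0 i is Some j then x 0 j else 0).
  by apply/funext => z; rewrite mxE.
by case: unlift => [j|]; [exact: coord_continuous|exact: cst_continuous].
Qed.

Lemma continuous_ball_to_cone : continuous ball_to_cone.
Proof.
move=> x; apply: continuous_rV_at => i.
have -> : (fun x => ball_to_cone x 0 i) =
    (fun x => embed x 0 i + (1 - eucl x - psi (embed x)) * p 0 i).
  by apply/funext => z; rewrite !mxE.
apply: (@continuous_add_at R 'rV[R]_n.-1).
  apply: (@continuous_comp _ _ _ embed (fun y : 'rV[R]_n => y 0 i)).
    exact: continuous_embed.
  exact: coord_continuous.
apply: (@continuous_mul_at R 'rV[R]_n.-1); last exact: cst_continuous.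
apply: (@continuous_sub_at R 'rV[R]_n.-1).
  apply: (@continuous_sub_at R 'rV[R]_n.-1); first exact: cst_continuous.
  by apply: continuous_eucl => j; exact: coord_continuous.
apply: (@continuous_comp _ _ _ embed psi); first exact: continuous_embed.
exact: psi_cont.
Qed.

(** The cone where [psi] is nonnegative is triangulated by the cones over the faces of [K], with
    generators [e z]; on it [alpha z] is the coefficient at [e z]. *)
Variables (T : finType) (K : {set {set T}}) (e : T -> 'rV[R]_n).
Variable alpha : T -> 'rV[R]_n -> R.
Hypothesis alpha_cont : forall z, continuous (alpha z).
Hypothesis alphaZ : forall z k y, 0 < k -> alpha z (k *: y) = k * alpha z y.
Hypothesis alpha_ge0 : forall z y, 0 <= alpha z y.
Hypothesis alpha_mem : forall y, 0 <= psi y -> [set z | alpha z y != 0]%SET \in K.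
Hypothesis alpha_sum : forall y, 0 <= psi y -> \sum_z alpha z y *: e z = y.
Hypothesis alphaK : forall c : T -> R, (forall z, 0 <= c z) ->
  [set z | c z != 0]%SET \in K ->
  0 <= psi (\sum_z c z *: e z) /\ forall z, alpha z (\sum_z c z *: e z) = c z.

Definition vector_of (a : 'rV[R]_#|T|) : 'rV[R]_n := \sum_z a 0 (enum_rank z) *: e z.

Definition normalized y : 'rV[R]_#|T| :=
  \row_i ((\sum_z alpha z y)^-1 * alpha (enum_val i) y).

Lemma alpha0 z : alpha z 0 = 0.
Proof. by have := alphaZ z 0 (ltr0Sn R 1); rewrite scaler0; lra. Qed.

Lemma alpha_sum_gt0 y : 0 <= psi y -> y != 0 -> 0 < \sum_z alpha z y.
Proof.
move=> y0; rewrite lt_neqAle sumr_ge0 // andbT eq_sym; apply: contra => /eqP s0.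
rewrite -(alpha_sum y0) big1 // => z _.
suff -> : alpha z y = 0 by rewrite scale0r.
apply/eqP; rewrite eq_le alpha_ge0 andbT [leRHS]s0 (bigD1 z) //= lerDl.
by apply: sumr_ge0 => w _; exact: alpha_ge0.
Qed.

Lemma vector_of_realization a : realization K a ->
  [/\ 0 <= psi (vector_of a), vector_of a != 0 &
    forall z, alpha z (vector_of a) = a 0 (enum_rank z)].
Proof.
move=> [a0 a1 aK]; have [y0 alE] := alphaK (fun z => a0 (enum_rank z)) aK.
split=> //; apply/eqP => ya; move: a1; rewrite big1 => [/eqP|i _].
  by rewrite eq_sym oner_eq0.
by rewrite -(enum_valK i) -alE -/(vector_of a) ya alpha0.
Qed.

Lemma realization_normalized y : 0 <= psi y -> y != 0 -> realization K (normalized y).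
Proof.
move=> y0 yn0; have s0 := alpha_sum_gt0 y0 yn0; split.
- by move=> i; rewrite mxE mulr_ge0 // invr_ge0 ltW.
- under eq_bigr do rewrite mxE.
  rewrite -mulr_sumr -(big_enum_val (A := predT) (fun z => alpha z y)) mulVf //.
  by rewrite gt_eqF.
have -> : [set z | normalized y 0 (enum_rank z) != 0]%SET = [set z | alpha z y != 0]%SET.
  by apply/setP => z; rewrite !finset.inE mxE enum_rankK mulf_eq0 invr_eq0 gt_eqF.
exact: alpha_mem.
Qed.

Lemma vector_of_normalized y : 0 <= psi y ->
  vector_of (normalized y) = (\sum_z alpha z y)^-1 *: y.
Proof.
move=> y0; rewrite -[in RHS](alpha_sum y0) scaler_sumr; apply: eq_bigr => z _.
by rewrite mxE enum_rankK scalerA (alpha_sum y0).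
Qed.

Lemma continuous_vector_of : continuous vector_of.
Proof.
move=> a; apply: continuous_rV_at => j.
have -> : (fun a => vector_of a 0 j) = (fun a => \sum_z a 0 (enum_rank z) * e z 0 j).
  by apply/funext => b; rewrite summxE; apply: eq_bigr => z _; rewrite mxE.
apply: (@continuous_sum_at R 'rV[R]_#|T|) => z.
apply: (@continuous_mul_at R 'rV[R]_#|T|); last exact: cst_continuous.
exact: coord_continuous.
Qed.

Lemma continuous_normalized y : 0 <= psi y -> y != 0 -> {for y, continuous normalized}.
Proof.
move=> y0 yn0; apply: continuous_rV_at => i.
have -> : (fun y => normalized y 0 i) =
    (fun y => (\sum_z alpha z y)^-1 * alpha (enum_val i) y).
  by apply/funext => z; rewrite mxE.
apply: (@continuous_mul_at R 'rV[R]_n); last exact: alpha_cont.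
apply: (@continuous_inv_at R 'rV[R]_n); first by rewrite gt_eqF // alpha_sum_gt0.
by apply: (@continuous_sum_at R 'rV[R]_n) => z; exact: alpha_cont.
Qed.

(** Realization and ball are two slices of the same cone, one by the sum of the [alpha z] and one by
    [eucl (shadow y) + psi y]. Going back and forth only rescales by positive factors, which each
    normalization absorbs. *)
Lemma star_shaped_ball : homeomorphic (@realization R T K) (@closed_ball_of_dim R n.-1).
Proof.
have in_ball x : @closed_ball_of_dim R n.-1 x -> 0 <= psi (ball_to_cone x).
  by rewrite /closed_ball_of_dim /= eucl_le1 psi_ball_to_cone subr_ge0.
exists (cone_to_ball \o vector_of), (normalized \o ball_to_cone); split.
- apply: continuous_in_subspaceT => a; rewrite inE => /vector_of_realization[y0 yn0 _].
  apply: continuous_comp; first exact: continuous_vector_of.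
  exact: continuous_cone_to_ball.
- apply: continuous_in_subspaceT => x; rewrite inE => /in_ball y0.
  apply: continuous_comp; first exact: continuous_ball_to_cone.
  by apply: continuous_normalized => //; exact: ball_to_cone_neq0.
- move=> a Ka; have [y0 yn0 alE] := vector_of_realization Ka; split.
    by rewrite /closed_ball_of_dim /= eucl_le1 cone_to_ball_le1.
  rewrite /= cone_to_ballK //; have k0 := cone_norm_gt0 y0 yn0.
  apply/rowP => i; rewrite mxE alphaZ ?invr_gt0 // alE enum_valK.
  rewrite (eq_bigr (fun z => (eucl (shadow (vector_of a)) + psi (vector_of a))^-1 *
     a 0 (enum_rank z))) => [|z _]; last by rewrite alphaZ ?invr_gt0 // alE.
  rewrite -mulr_sumr; have [_ a1 _] := Ka.
  have -> : \sum_z a 0 (enum_rank z) = 1.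
    by rewrite -a1 [RHS](reindex _ (onW_bij _ (@enum_rank_bij T))).
  by rewrite mulr1 invrK mulrA divff ?mul1r // gt_eqF.
- move=> x /in_ball y0; have yn0 := ball_to_cone_neq0 x; split.
    exact: realization_normalized.
  rewrite /= vector_of_normalized // cone_to_ballZ ?ball_to_coneK //.
  by rewrite invr_gt0 alpha_sum_gt0.
Qed.

End StarShapedCone.

Lemma min_equivariant (R : realType) (I : Type) (P : pred I) (f f' : I -> R) (h : R -> R) m m' :
  {homo h : x y / x <= y} -> (forall i, P i -> f' i = h (f i)) ->
  (forall i, P i -> m <= f i) /\ (exists2 i, P i & m = f i) ->
  (forall i, P i -> m' <= f' i) /\ (exists2 i, P i & m' = f' i) -> m' = h m.
Proof.
move=> hh ff' [le_m [i Pi mi]] [le_m' [j Pj m'j]]; apply/eqP; rewrite eq_le.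
by rewrite {1}mi -ff' // le_m' // m'j ff' // hh // le_m.
Qed.

Lemma max_equivariant (R : realType) (I : Type) (P : pred I) (f f' : I -> R) (h : R -> R) m m' :
  {homo h : x y / x <= y} -> (forall i, P i -> f' i = h (f i)) ->
  (forall i, P i -> f i <= m) /\ (exists2 i, P i & m = f i) ->
  (forall i, P i -> f' i <= m') /\ (exists2 i, P i & m' = f' i) -> m' = h m.
Proof.
move=> hh ff' [le_m [i Pi mi]] [le_m' [j Pj m'j]]; apply/eqP; rewrite eq_le.
by rewrite {1}m'j ff' // hh ?le_m //= mi -ff' // le_m'.
Qed.

(** * The later ears are balls *)

Section EarBall.
Variables (R : realType) (r : nat) (S : {set 'I_r.+1}).
Hypothesis hS : forall j : 'I_r.+1, j \in S -> (0 < j < r)%N.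
Variable s : 'S_r.
Implicit Types (t : 'S_r) (a b c : 'I_r) (z w : {set 'I_r}) (y : 'rV[R]_#|S|).
Implicit Types (p q : 'I_r * 'I_r).
Local Notation eq_off := (eq_off S).
Local Notation same_block := (same_block S).
Local Notation ascending := (ascending S).
Local Notation facet := (facet S).
Local Notation vertices := (ear_vertices S s).
Local Notation rank j := (val (enum_val j) : nat).
Local Notation ear_dir := (ear_dir R S s).
Local Notation level := (level s).
Local Notation gaps := (gaps S).
Local Notation inverted := (inverted S s).
Local Notation remedy := (remedy S s).

Lemma continuous_level a : continuous (fun y => level y a).
Proof. exact: continuous_dot. Qed.

(** The denominator normalizes the slope of [axis] to 1, since the levels of [axis] differ inside a
    block as the letters do. *)
Definition slope p y : R := (level y p.2 - level y p.1) / ((p.2 : nat)%:R - (p.1 : nat)%:R).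

Definition axis : 'rV[R]_#|S| := gaps s (fun a => (a : nat)%:R).

Lemma continuous_slope p : continuous (slope p).
Proof.
move=> y; apply: (@continuous_mul_at R 'rV[R]_#|S|); last exact: cst_continuous.
by apply: (@continuous_sub_at R 'rV[R]_#|S|); exact: continuous_level.
Qed.

Lemma slopeZ p k y : slope p (k *: y) = k * slope p y.
Proof. by rewrite /slope !levelZ -mulrBr mulrA. Qed.

Lemma slope_axis q p k y : remedy q p -> slope p (y + k *: axis) = slope p y + k.
Proof.
case/and3P => sp lt_p _; rewrite /slope !levelD !levelZ.
have : level axis p.1 - level axis p.2 = (p.1 : nat)%:R - (p.2 : nat)%:R.
  exact: (level_gaps (fun a : 'I_r => (a : nat)%:R : R)).
have : (p.1 : nat)%:R < (p.2 : nat)%:R :> R by rewrite ltr_nat.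
move=> lt12 e; rewrite -[level axis p.2](subrK (level axis p.1)) -opprB e.
by field; rewrite subr_eq0 gt_eqF.
Qed.

Lemma slope_ge0 q p y : remedy q p -> (0 <= slope p y) = (level y p.1 <= level y p.2).
Proof.
case/and3P => _ lt_p _; rewrite pmulr_lge0 ?subr_ge0 //.
by rewrite invr_gt0 subr_gt0 ltr_nat.
Qed.

(** [psi] is the minimum over the inverted pairs of the maximum of the slopes of their remedies. It
    is nonnegative exactly when each inverted pair has a remedy of nonnegative slope; scaling and
    translation pass through both extrema. *)
Lemma exists_psi : (exists q, inverted q) -> (forall q, inverted q -> exists p, remedy q p) ->
  exists psi : 'rV[R]_#|S| -> R, [/\ continuous psi,
    forall k y, 0 < k -> psi (k *: y) = k * psi y,
    forall k y, psi (y + k *: axis) = psi y + k &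
    forall y, 0 <= psi y <->
      forall q, inverted q -> exists2 p, remedy q p & level y p.1 <= level y p.2].
Proof.
move=> exq exp.
have /choice[G GP] q : exists g : 'rV[R]_#|S| -> R, continuous g /\ (inverted q ->
    forall y, (forall p, remedy q p -> slope p y <= g y) /\
      exists2 p, remedy q p & g y = slope p y).
  (* Pairs that are not inverted get the zero function, which does not enter the minimum. *)
  have [iq|niq] := boolP (inverted q); last by exists (fun=> 0); split=> //; exact: cst_continuous.
  have [g [gc gP]] := finite_max (exp q iq) continuous_slope.
  by exists g; split=> // _.
have Gc q : continuous (G q) by case: (GP q).
have [psi [psic psiP]] := finite_min exq Gc.
exists psi; split=> //.
- move=> k y k0; apply: (min_equivariant (h := fun x => k * x) _ _ (psiP y) (psiP (k *: y))).
    by move=> x x' xx'; rewrite ler_wpM2l // ltW.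
  move=> q iq; have [_ /(_ iq) gP] := GP q.
  apply: (max_equivariant (h := fun x => k * x) _ _ (gP y) (gP (k *: y))).
    by move=> x x' xx'; rewrite ler_wpM2l // ltW.
  by move=> p _; exact: slopeZ.
- move=> k y; apply: (min_equivariant (h := fun x => x + k) _ _ (psiP y) (psiP (y + k *: axis))).
    by move=> x x' xx'; rewrite lerD2r.
  move=> q iq; have [_ /(_ iq) gP] := GP q.
  apply: (max_equivariant (h := fun x => x + k) _ _ (gP y) (gP (y + k *: axis))).
    by move=> x x' xx'; rewrite lerD2r.
  by move=> p; exact: slope_axis.
move=> y; have [le_psi [q0 iq0 psiq0]] := psiP y; split=> [y0 q iq|H].
  have [_ /(_ iq y)[le_g [p rp gp]]] := GP q; exists p => //.
  by rewrite -(slope_ge0 _ rp) -gp (le_trans y0) // le_psi.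
have [_ /(_ iq0 y)[le_g _]] := GP q0; have [p rp le_p] := H q0 iq0.
by rewrite psiq0 (le_trans _ (le_g p rp)) // (slope_ge0 _ rp).
Qed.

(** For a vertex [z] the function is the positive part of the minimum over cut pairs from
    [gaps_facet_le] and its companions, hence continuous across the cones. *)
Lemma exists_alpha z : exists al : 'rV[R]_#|S| -> R, continuous al /\
  forall t y, eq_off s t -> (forall j, 0 <= gaps t (level y) 0 j) ->
    (forall j : 'I_#|S|, z = prefix_set t (rank j) -> al y = gaps t (level y) 0 j) /\
    (z \notin facet t -> al y = 0).
Proof.
have [zs|nzs] := boolP (z \in vertices); last first.
  exists (fun=> 0); split; first exact: cst_continuous.
  move=> t y st _; split=> // j zj; case/negP: nzs.
  by rewrite zj; apply: (fintype.subsetP (facet_sub hS st)); rewrite mem_facet ?rank_selected_val.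
pose P p := [&& same_block s p.1 p.2, p.1 \in z & p.2 \notin z].
pose F p y := level y p.1 - level y p.2.
have exP : exists p, P p.
  have zs1 : [set z]%SET \subset vertices by rewrite finset.sub1set.
  have [t [j [st _ zj]]] := vertexP zs1 (chain_set1 z) (set11 z).
  have [p [p1 p2 p3 _]] := gaps_facet_attained hS (0 : 'rV[R]_#|S|) j st.
  by exists p; rewrite /P zj p1 p2.
have Fc p : continuous (F p).
  by move=> y; apply: (@continuous_sub_at R 'rV[R]_#|S|); exact: continuous_level.
have [m [mc mP]] := finite_min exP Fc.
exists (fun y => Num.max 0 (m y)); split.
  by move=> y; apply: continuous_max; [exact: cst_continuous|exact: mc].
move=> t y st g0; have [le_m [p /and3P[sp p1 p2] mp]] := mP y; split=> [j zj|zt].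
  have -> : m y = gaps t (level y) 0 j; last by rewrite max_r.
  apply/eqP; rewrite eq_le; apply/andP; split.
    have [p' [sp' p1' p2' <-]] := gaps_facet_attained hS y j st.
    by apply: (le_m p'); rewrite /P zj sp' p1'.
  by rewrite mp; apply: (gaps_facet_le st g0); rewrite -?zj.
have [p' [sp' p1' p2' le0]] := gaps_off_facet st g0 zs zt.
by rewrite max_l // (le_trans _ le0) // (le_m p') // /P sp' p1'.
Qed.

(** The permutation [v] provides an inverted pair, so that the minimum defining [psi] is over a
    nonempty set. *)
Lemma ear_ball (K : {set {set {set 'I_r}}}) v :
  ascending s -> eq_off s v -> ~~ ascending v ->
  (forall A : {set {set 'I_r}},
    reflect (exists t, [/\ eq_off s t, ascending t & A \subset facet t]) (A \in K)) ->
  homeomorphic (@realization R _ K) (@closed_ball_of_dim R #|S|.-1).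
Proof.
move=> as_ sv nav KP; have [q [iq _ _]] := not_ascending_inverted sv nav.
(* A remedy needs two letters in one block, hence a selected rank [j]. The axis has a nonzero
   coordinate there, the one that [shadow] eliminates. *)
have [/card_gt0P[j jS] _] := remedy_nonempty as_ iq.
have [|p ip|psi [psic psiZ psiD psiP]] := exists_psi; first by exists q.
  by have [] := remedy_nonempty as_ ip.
have /choice[al alP] := exists_alpha.
have alc z : continuous (al z) by case: (alP z).
have alE z t y : eq_off s t -> (forall j, 0 <= gaps t (level y) 0 j) ->
    (forall j : 'I_#|S|, z = prefix_set t (rank j) -> al z y = gaps t (level y) 0 j) /\
    (z \notin facet t -> al z y = 0) by move=> st g0; case: (alP z) => _ /(_ t y st g0).
have facet_rank t z : z \in facet t -> exists j : 'I_#|S|, z = prefix_set t (rank j).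
  by move=> /imsetP[k kS ->]; exists (enum_rank_in kS k); rewrite enum_rankK_in.
have al_ge0 z y : 0 <= al z y.
  have [t st g0] := sorted_gaps hS s y; have [H1 H2] := alE z t y st g0.
  by have [/facet_rank[i /H1 ->]|/H2 ->] := boolP (z \in facet t).
have gapsZ k t y : gaps t (level (k *: y)) = k *: gaps t (level y).
  apply/rowP => i; have [a [b [ai bi _ _]]] := rank_letters hS t i.
  by rewrite !mxE -ai -bi !at_positionE !levelZ mulrBr.
have alZ z k y : 0 < k -> al z (k *: y) = k * al z y.
  move=> k0; have [t st g0] := sorted_gaps hS s y.
  have gk i : 0 <= gaps t (level (k *: y)) 0 i by rewrite gapsZ mxE mulr_ge0 // ltW.
  have [H1 H2] := alE z t y st g0; have [H3 H4] := alE z t _ st gk.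
  have [/facet_rank[i zi]|zt] := boolP (z \in facet t).
    by rewrite (H1 i zi) (H3 i zi) gapsZ mxE.
  by rewrite H2 ?H4 // mulr0.
have sum_al t (c : {set 'I_r} -> R) : (forall z, z \notin facet t -> c z = 0) ->
    \sum_z c z *: ear_dir z =
    \sum_(i < #|S|) c (prefix_set t (rank i)) *: ear_dir (prefix_set t (rank i)).
  move=> c0; rewrite (bigID (mem (facet t))) /= [X in _ + X]big1 ?addr0; last first.
    by move=> z /c0 ->; rewrite scale0r.
  exact: (sum_facet S t (fun z => c z *: ear_dir z)).
have axis0 : axis 0 (enum_rank_in jS j) != 0.
  have [a [b [ai bi ab _]]] := rank_letters hS s (enum_rank_in jS j).
  rewrite mxE -ai -bi !at_positionE subr_eq0 eqr_nat; apply/eqP => /val_inj e.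
  by rewrite e in ab; have := n_Sn (position s b); rewrite ab.
apply: (@star_shaped_ball R #|S| axis (enum_rank_in jS j) axis0
  psi psic psiZ psiD _ K ear_dir al) => //.
- move=> y /psiP/(remedied_sorted_ascending hS)[t [st at_ g0]].
  apply/KP; exists t; split=> //; apply/fintype.subsetP => z; rewrite finset.inE.
  by apply: contraNT => /(alE z t y st g0).2 ->.
- move=> y /psiP/(remedied_sorted_ascending hS)[t [st at_ g0]].
  rewrite (sum_al t) => [|z /(alE z t y st g0).2 //].
  rewrite [RHS](dir_sum hS y st); apply: eq_bigr => i _.
  by rewrite ((alE _ t y st g0).1 i erefl).
move=> c c0 /KP[t [st at_ /fintype.subsetP ct]].
have ct' z : z \notin facet t -> c z = 0.
  by move=> zt; apply/eqP; apply: contraNT zt => cz; apply: ct; rewrite finset.inE.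
rewrite (sum_al t c ct'); set y := \sum_(i < _) _.
have gE i : gaps t (level y) 0 i = c (prefix_set t (rank i)).
  by rewrite /y (gaps_dir_sum hS (fun i => c (prefix_set t (rank i))) st) mxE.
have g0 i : 0 <= gaps t (level y) 0 i by rewrite gE.
split; first by apply/psiP; exact: ascending_remedied st at_ g0.
move=> z; have [H1 H2] := alE z t y st g0.
by have [/facet_rank[i zi]|zt] := boolP (z \in facet t); [rewrite (H1 i zi) gE zi|rewrite H2 ?ct'].
Qed.

End EarBall.

(** * Assembly of the decomposition *)

Section ConvexEars.
Variables (R : realType) (r : nat) (S : {set 'I_r.+1}).
Hypothesis hS : forall j : 'I_r.+1, j \in S -> (0 < j < r)%N.
Local Notation perms := (perms_with_descents S).
Local Notation nth_perm i := (nth 1%g perms i).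
Local Notation Sigma i := (nth finset.set0 (ears S) i).
Local Notation sphere s :=
  [set A : {set {set 'I_r}} | (A \subset ear_vertices S s) && chain_set A]%SET.

Lemma ear_sub_sphere i : (i < size perms)%N -> Sigma i \subset sphere (nth_perm i).
Proof.
move=> ip; apply/fintype.subsetP => A /(earP hS _ ip)[t [st _ At]].
rewrite finset.inE (fintype.subset_trans At (facet_sub hS st)).
exact: chain_setS At (facet_chain _ _).
Qed.

(** With no earlier subposet to remove chains, the facet above any chain of the sphere belongs to
    the ear. *)
Lemma first_ear : Sigma 0 = sphere (nth_perm 0).
Proof.
have p0 := size_perms_gt0 hS.
apply/eqP; rewrite finset.eqEsubset ear_sub_sphere //=.
apply/fintype.subsetP => A; rewrite finset.inE => /andP[As chA].
have [t [st At _]] := extend_facet (fun a : 'I_r => a : nat) As chA.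
have : facet S t \in ear_facets S 0.
  by rewrite /ear_facets big_ord0 finset.setD0 facet_maximal_chain.
by move=> /(ear_facetsP hS _ p0)[u [su au tu]]; apply/earP => //; exists u; rewrite -tu.
Qed.

Lemma vertices_sphere s (K : {set {set {set 'I_r}}}) : K \subset sphere s ->
  {subset vertices K <= ear_vertices S s}.
Proof.
move=> /fintype.subsetP Ks z /finset.bigcupP[A /Ks].
by rewrite finset.inE => /andP[/fintype.subsetP As _]; exact: As.
Qed.

Lemma sphere_polytope_boundary s : is_polytope_boundary R #|S| (sphere s).
Proof.
exists #|S|, (@ear_polytope R r S s), (ear_point R S s); split.
- exact: ear_polytope_simplicial.
- move=> z w zK wK; apply: (point_inj hS (s := s)); exact: vertices_sphere (subxx _) _ _.
- exact: ear_boundary_complex.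
Qed.

Lemma proper_in_sphere_boundary s (K : {set {set {set 'I_r}}}) : K \proper sphere s ->
  is_proper_in_polytope_boundary R #|S| K.
Proof.
case/properP => Ks [F Fs FK]; exists #|S|, (@ear_polytope R r S s), (ear_point R S s); split.
- exact: ear_polytope_simplicial.
- by move=> z w zK wK; apply: (point_inj hS (s := s)); exact: vertices_sphere Ks _ _.
rewrite -ear_boundary_complex //; split.
  by move=> _ [A /(fintype.subsetP Ks) As <-]; exists A.
move=> /(_ (ear_point R S s @` [set` F])%classic)[|A AK AF]; first by exists F.
case/negP: FK; suff -> : F = A by [].
have mem (B : {set {set 'I_r}}) z : B \in sphere s -> z \in B -> z \in ear_vertices S s.
  by rewrite finset.inE => /andP[/fintype.subsetP Bs _]; exact: Bs.
have As := fintype.subsetP Ks A AK.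
apply/setP => z; apply/idP/idP => [zF|zA].
  have : (ear_point R S s @` [set` A])%classic (ear_point R S s z) by rewrite AF; exists z.
  by move=> [w wA /(point_inj hS (mem _ _ As wA) (mem _ _ Fs zF)) <-].
have : (ear_point R S s @` [set` F])%classic (ear_point R S s z) by rewrite -AF; exists z.
by move=> [w wF /(point_inj hS (mem _ _ Fs wF) (mem _ _ As zA)) <-].
Qed.

(** The empty face lies in the first ear, so it is not separating for the [i]-th permutation, and
    the boundary pair it yields contains such a [v]. *)
Lemma later_ear_not_ascending i : (0 < i < size perms)%N ->
  exists2 v, eq_off S (nth_perm i) v & ~~ ascending S v.
Proof.
move=> /andP[i0 ip]; have set0_ear j : (j < size perms)%N -> finset.set0 \in Sigma j.
  by move=> jp; have /andP[] := ear_complex hS jp.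
have nsep : ~ separating S finset.set0 (nth_perm i).
  apply: (not_separating hS ip); apply/finset.bigcupP; exists (Ordinal i0) => //.
  exact/set0_ear/(size_perms_gt0 hS).
have [u [v [k [_ [sv nav _] _ _ _]]]] := ear_boundary_pair hS ip (set0_ear _ ip) nsep.
by exists v.
Qed.

Lemma later_ear_proper i : (0 < i < size perms)%N -> Sigma i \proper sphere (nth_perm i).
Proof.
move=> i0p; have [v sv nav] := later_ear_not_ascending i0p; have /andP[_ ip] := i0p.
apply/properP; split; first exact: ear_sub_sphere.
exists (facet S v); first by rewrite finset.inE facet_sub // facet_chain.
apply/negP => /(earP hS _ ip)[t [st at_ vt]]; case/negP: nav.
suff -> : v = t by [].
apply: (facet_inj hS (eq_off_trans (eq_off_sym sv) st)).
by apply/eqP; rewrite finset.eqEcard vt !card_facet /=.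
Qed.

Lemma later_ear_ball i : (0 < i < size perms)%N -> simplicial_ball R (Sigma i).
Proof.
move=> i0p; have [v sv nav] := later_ear_not_ascending i0p; have /andP[_ ip] := i0p.
split; first exact: ear_complex.
have [as_ _] := nth_permP hS ip.
by rewrite dim1_ear //; apply: (ear_ball R hS as_ sv nav) => A; exact: earP.
Qed.

End ConvexEars.

Theorem theorem4p1 (R : realType) (r : nat) (S : {set 'I_r.+1})
    (hS : forall j : 'I_r.+1, j \in S -> (0 < j < r)%N) :
  convex_ear_decomposition R (order_complex (rank_selected S)) (ears S).
Proof.
rewrite /convex_ear_decomposition dim1_order_complex // size_ears.
split; first split; [exact: order_complex_simplicial|exact: size_perms_gt0| |].
  by move=> i ip; rewrite ear_complex // ear_sub.
split.
- exact: bigcup_ears.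
- split=> [|i i0p]; first by rewrite first_ear //; exact: sphere_polytope_boundary.
  have /andP[_ ip] := i0p; rewrite dim1_ear //; split=> //.
  exact/(proper_in_sphere_boundary R hS)/later_ear_proper.
- by move=> i; exact: later_ear_ball.
- by move=> i /andP[_ ip]; exact: earlier_ears_boundary.
Qed.
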